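(* Let $\ell\geq2$. For all $i=1,\dots,\ell+1$, the operator $\pi(z_i)-W^*\rho(z_i)W$ is a finite sum of shift operators on $\mathcal H$ with weights bounded by $q^h$, i.e. each of these shift operators maps every basis vector $|n,h;\mathbf r\rangle$ to a multiple, of modulus at most $Cq^h$ with $C$ a constant independent of $n,h,\mathbf r$, of a basis vector.
   Context: Fix $0<q<1$; $[x]=(q^x-q^{-x})/(q-q^{-1})$. $\mathcal A(S^{2\ell+1}_q)$ is the unital $*$-algebra generated by $z_i,z_i^*$ ($i=1,\dots,\ell+1$) with relations $z_iz_j=qz_jz_i$ ($i<j$), $z_i^*z_j=qz_jz_i^*$ ($i\ne j$), $[z_1^*,z_1]=0$, $[z_{i+1}^*,z_{i+1}]=(1-q^2)\sum_{j=1}^iz_jz_j^*$ ($1\le i\le\ell$), $\sum_{i=1}^{\ell+1}z_iz_i^*=1$. Gelfand--Tsetlin (GT) tableaux: arrays of integers $\mathbf r=(r_{i,j})$, $1\le i\le\ell+1$, $1\le j\le\ell+2-i$, with $r_{1,\ell+1}=0$ and $r_{i,j}\ge r_{i+1,j}\ge r_{i,j+1}$ for all $i,j$ (set $r_{i,j}=0$ out of range). $\mathcal H$ is the Hilbert space with orthonormal basis $|n,h;\mathbf r\rangle$, $n,h\in\mathbb N$ and $\mathbf r$ a GT tableau with $(r_{1,1},\dots,r_{1,\ell})=(n+h,h,\dots,h)$. For $1\le k\le\ell+1$ let $\Gamma^{(k)}=\{m\in\mathbb N^k:1\le m_i\le\ell+2-i\}$; for $m\in\Gamma^{(k)}$ let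 $\mathbf r^{(m)}$ be the array with $r^{(m)}_{ij}=-\delta_{m_1,\ell+1}+r_{ij}+1$ if $j=m_i$, $1\le i\le k$, and $r^{(m)}_{ij}=-\delta_{m_1,\ell+1}+r_{ij}$ otherwise. The left regular representation $\pi:\mathcal A(S^{2\ell+1}_q)\to\mathcal B(\mathcal H)$ is the $*$-representation with $$\begin{aligned}\pi(z_{\ell+2-i}^* )|n,h;\mathbf r\rangle&=q^{-\frac12(\ell+h)}\tfrac{[n+1]^{1/2}}{[n+h+\ell+1]^{1/2}}\sum_{m\in\Gamma^{(i)}:m_1=1}q^{\ell+h}q^{-i+1}C_q(i,\mathbf r,m)|n+1,h;\mathbf r^{(m)}\rangle\\&\quad+q^{-\frac12n}\tfrac{[h+\ell-1]^{1/2}}{[n+h+\ell-1]^{1/2}}\sum_{m\in\Gamma^{(i)}:m_1=\ell+1}q^{-i+1}C_q(i,\mathbf r,m)|n,h-1;\mathbf r^{(m)}\rangle,\end{aligned}$$ where summands for which $\mathbf r^{(m)}$ is not a GT tableau are set to zero and $$\begin{aligned}C_q(i,\mathbf r,m)&=q^{\frac12\left(1+m_1-2m_i-r_{1,m_1}+2r_{i,m_i}-r_{i,\ell+2-i}+\sum_{k=1}^{\ell+1-i}(r_{i+1,k}-r_{i,k})\right)}\Big\{\prod_{k=1}^{i-1}\mathrm{sign}(m_k-m_{k+1})\Big\}\\ &\times\Big\{\prod_{k=1}^{i-1}\ \prod_{j=1,\,j\ne m_k}^{\ell+2-k}\tfrac{[r_{k,j}-r_{k+1,m_{k+1}}-j+m_{k+1}]}{[r_{k,j}-r_{k,m_k}-j+m_k]}\prod_{j=1,\,j\neq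 m_{k+1}}^{\ell+1-k}\tfrac{[r_{k+1,j}-r_{k,m_k}-j+m_k-1]}{[r_{k+1,j}-r_{k+1,m_{k+1}}-j+m_{k+1}-1]}\Big\}^{1/2}\\ &\times\left(\frac{\prod_{k=1}^{\ell+1-i}[r_{i+1,k}-r_{i,m_i}-k+m_i-1]}{\prod_{k=1,\,k\ne m_i}^{\ell+2-i}[r_{i,k}-r_{i,m_i}-k+m_i]}\right)^{1/2},\end{aligned}$$ with $\mathrm{sign}(0)=1$, empty sums $0$, empty products $1$. Let $\Lambda$ be the set of $(n,h;\mathbf a,\mathbf b)$ with $n,h\in\mathbb N$, $\mathbf a=(a_1,\dots,a_{\ell-1})\in\mathbb Z^{\ell-1}$, $\mathbf b=(b_0,\dots,b_{\ell-1})\in\mathbb Z^\ell$, $0\le a_1\le\cdots\le a_{\ell-1}\le n$, $b_0\le b_1\le\cdots\le b_{\ell-1}\le h$, and let $\hat{\mathcal H}$ be the Hilbert space with orthonormal basis $|n,h;\mathbf a,\mathbf b\rangle\rangle$ labelled by $\Lambda$. Put $b_\ell:=h$ and, for $1\le i\le\ell+1$, let $\underline i\in\{0,1\}^\ell$ be the array of $i-1$ zeros followed by $\ell+1-i$ ones. The $*$-representation $\rho:\mathcal A(S^{2\ell+1}_q)\to\mathcal B(\hat{\mathcal H})$ is $$\rho(z_1)|n,h;\mathbf a,\mathbf b\rangle\rangle=q^{h-b_0}|n,h+1;\mathbf a,\mathbf b+\underline1\rangle\rangle,$$ $$\rho(z_i)|n,h;\mathbf a,\mathbf b\rangle\rangle=q^{h-b_{i-1}}\sqrt{1-q^{2(b_{i-1}-b_{i-2}+1)}}\;|n,h+1;\mathbf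 a,\mathbf b+\underline i\rangle\rangle\qquad(2\le i\le\ell+1).$$ The partial isometry $W:\mathcal H\to\hat{\mathcal H}$ (with $W^*W=1$) is $W|n,h;\mathbf r\rangle=|n,h;\mathbf a(\mathbf r),\mathbf b(\mathbf r)\rangle\rangle$, where $a_j(\mathbf r)=r_{\ell+1-j,1}-h$ ($1\le j\le\ell-1$) and $b_k(\mathbf r)=h-r_{\ell+1-k,k+1}$ ($0\le k\le\ell-1$). A shift operator on $\mathcal H$ is an operator whose matrix in the basis $|n,h;\mathbf r\rangle$ has at most one non-zero entry in each row and in each column; its matrix entries are called its weights. *)

(* Defs.v *)
From HB Require Import structures.
From mathcomp Require Export all_boot all_order all_algebra.
From mathcomp Require Export sesquilinear complex.
From mathcomp Require Export all_classical all_reals all_analysis.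

Set Implicit Arguments.
Unset Strict Implicit.
Unset Printing Implicit Defensive.

Export Order.TTheory GRing.Theory Num.Theory.
Export numFieldNormedType.Exports.

#[global] Open Scope classical_set_scope.
#[global] Open Scope ring_scope.
#[global] Open Scope complex_scope.

(* [hdot] is linear in its first argument and conjugate-linear in the second. *)
Record hilbert (R : realType) := Hilbert {
  hcarrier :> completeNormedModType R[i];
  hdot : {dot hcarrier for (@Num.conj R[i])};
  hdot_norm : forall x : hcarrier, hdot x x = `|x| ^+ 2 }.

Arguments hdot {R h}.

Record bounded_op (R : realType) (H K : hilbert R) := BoundedOp {
  bop_fun :> {linear H -> K};
  bop_continuous : continuous bop_fun }.

Definition orthonormal_basis (R : realType) (H : hilbert R) (I : choiceType)
    (e : I -> H) : Prop :=
  (forall x y : I, hdot (e x) (e y) = (x == y)%:R) /\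
  closure [set v : H | exists (s : seq I) (c : I -> R[i]),
                         v = \sum_(x <- s) c x *: e x] = [set: H].

Definition adjoint_ops (R : realType) (H K : hilbert R)
    (T : bounded_op H K) (Ts : bounded_op K H) : Prop :=
  forall (x : H) (y : K), hdot (T x) y = hdot x (Ts y).

(* The entry in row [y] and column [x] of the matrix of [T] in the basis [e]. *)
Definition mx_entry (R : realType) (H : hilbert R) (I : choiceType)
    (e : I -> H) (T : bounded_op H H) (y x : I) : R[i] :=
  hdot (T (e x)) (e y).

Definition shift_operator (R : realType) (H : hilbert R) (I : choiceType)
    (e : I -> H) (T : bounded_op H H) : Prop :=
  (forall x y y' : I,
     mx_entry e T y x != 0 -> mx_entry e T y' x != 0 -> y = y') /\
  (forall y x x' : I,
     mx_entry e T y x != 0 -> mx_entry e T y x' != 0 -> x = x').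

Definition qnum (R : realType) (q : R) (x : int) : R :=
  (q ^ x - q ^ (- x)) / (q - q^-1).

Definition qhalf (R : realType) (q : R) (x : int) : R := q `^ (x%:~R / 2).

(* Indices start at 1, as in the usual notation r_{i,j}. *)
Definition cell (l : nat) :=
  {p : 'I_l.+2 * 'I_l.+2 | [&& 0 < p.1, 0 < p.2 & p.1 + p.2 <= l.+2]%N}.

Definition cell_row (l : nat) (c : cell l) : nat := (val c).1.
Definition cell_col (l : nat) (c : cell l) : nat := (val c).2.

Definition array (l : nat) := {ffun cell l -> int}.

Definition entry (l : nat) (r : array l) (i j : nat) : int :=
  if [pick c : cell l | (cell_row c == i) && (cell_col c == j)] is Some c
  then r c else 0.

Definition is_GT (l : nat) (r : array l) : bool :=
  (entry r 1 l.+1 == 0) &&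
  [forall i : 'I_l.+2, forall j : 'I_l.+2,
     [&& 0 < i, 0 < j & i + j <= l.+1]%N ==>
     (entry r i j.+1 <= entry r i.+1 j <= entry r i j)].

Definition is_GT_label (l : nat) (x : nat * nat * array l) : bool :=
  let: (n, h, r) := x in
  [&& is_GT r, entry r 1 1 == (n + h)%N%:Z
    & [forall j : 'I_l.+1, (2 <= j)%N ==> (entry r 1 j == h%:Z)]].

Definition GT_label (l : nat) := {x : nat * nat * array l | is_GT_label x}.

Definition GT_n (l : nat) (x : GT_label l) : nat := (val x).1.1.
Definition GT_h (l : nat) (x : GT_label l) : nat := (val x).1.2.
Definition GT_tab (l : nat) (x : GT_label l) : array l := (val x).2.

(* |n,h;r>, set to 0 when (n,h;r) does not label a basis vector. *)
Definition ket (R : realType) (l : nat) (H : hilbert R) (e : GT_label l -> H)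
    (n h : nat) (r : array l) : H :=
  if insub (n, h, r) is Some x then e x else 0.

(* m_k; the index k starts at 1. *)
Definition mcomp (l i : nat) (m : i.-tuple 'I_l.+2) (k : nat) : nat :=
  nth ord0 m k.-1.

Definition in_Gamma (l i : nat) (m : i.-tuple 'I_l.+2) : bool :=
  [forall t : 'I_i, (0 < tnth m t <= l.+1 - t)%N].

(* r^(m), where the subtracted term is delta_{m_1,l+1} *)
Definition shift_array (l i : nat) (r : array l) (m : i.-tuple 'I_l.+2) : array l :=
  [ffun c : cell l =>
     r c - (mcomp m 1 == l.+1)%:Z
     + ((cell_row c <= i)%N && (cell_col c == mcomp m (cell_row c)))%:Z].

Section Cq.
Variables (R : realType) (q : R) (l i : nat) (r : array l) (m : i.-tuple 'I_l.+2).

Local Notation "[[ x ]]" := (qnum q x) (at level 0, x at level 99).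
Local Notation r_ := (entry r).
Local Notation mz k := ((mcomp m k)%:Z).

Definition Cq_exponent : int :=
  1 + mz 1 - 2 * mz i - r_ 1 (mcomp m 1) + 2 * r_ i (mcomp m i)
  - r_ i (l.+2 - i)
  + \sum_(1 <= k < l.+2 - i) (r_ i.+1 k - r_ i k).

(* The sign of m_k - m_{k+1}, with the convention sign(0) = 1. *)
Definition Cq_sign : R :=
  \prod_(1 <= k < i) (if (mcomp m k.+1 <= mcomp m k)%N then 1 else -1).

Definition Cq_middle : R :=
  \prod_(1 <= k < i)
    ((\prod_(1 <= j < l.+3 - k | j != mcomp m k)
        ([[ r_ k j - r_ k.+1 (mcomp m k.+1) - j%:Z + mz k.+1 ]] /
         [[ r_ k j - r_ k (mcomp m k) - j%:Z + mz k ]])) *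
     (\prod_(1 <= j < l.+2 - k | j != mcomp m k.+1)
        ([[ r_ k.+1 j - r_ k (mcomp m k) - j%:Z + mz k - 1 ]] /
         [[ r_ k.+1 j - r_ k.+1 (mcomp m k.+1) - j%:Z + mz k.+1 - 1 ]]))).

Definition Cq_last : R :=
  (\prod_(1 <= k < l.+2 - i)
     [[ r_ i.+1 k - r_ i (mcomp m i) - k%:Z + mz i - 1 ]]) /
  (\prod_(1 <= k < l.+3 - i | k != mcomp m i)
     [[ r_ i k - r_ i (mcomp m i) - k%:Z + mz i ]]).

Definition Cq : R :=
  qhalf q Cq_exponent * Cq_sign * Num.sqrt Cq_middle * Num.sqrt Cq_last.

End Cq.

(* pi(z_{l+2-i}^* )|n,h;r> *)
Definition pi_zstar_ket (R : realType) (q : R) (l : nat) (H : hilbert R)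
    (e : GT_label l -> H) (i n h : nat) (r : array l) : H :=
  (qhalf q (- (l + h)%N%:Z)
     * (Num.sqrt (qnum q n.+1%:Z) / Num.sqrt (qnum q (n + h + l + 1)%N%:Z)))%:C
  *: (\sum_(m : i.-tuple 'I_l.+2 | in_Gamma m && (mcomp m 1 == 1%N))
        (q ^+ (l + h) * q ^ (1 - i%:Z) * Cq q r m)%:C
        *: ket e n.+1 h (shift_array r m))
  + (qhalf q (- n%:Z)
       * (Num.sqrt (qnum q (h%:Z + l%:Z - 1))
          / Num.sqrt (qnum q (n%:Z + h%:Z + l%:Z - 1))))%:C
    *: (\sum_(m : i.-tuple 'I_l.+2 | in_Gamma m && (mcomp m 1 == l.+1))
          (q ^ (1 - i%:Z) * Cq q r m)%:C
          (* for h = 0 the array [shift_array r m] is never a GT tableau *)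
          *: ket e n h.-1 (shift_array r m)).

(* [piz i] and [pizs i] stand for pi(z_i) and pi(z_i^* ), 1 <= i <= l+1.  The
   formula determines pi(z_i^* ), hence its adjoint pi(z_i).  The defining
   relations of the quantum sphere are deliberately not imposed: with
   sign(0) = 1 the formula does not satisfy them, so that requiring them would
   make this predicate empty. *)
Definition left_regular (R : realType) (q : R) (l : nat) (H : hilbert R)
    (e : GT_label l -> H) (piz pizs : nat -> bounded_op H H) : Prop :=
  (forall i, (1 <= i <= l.+1)%N -> adjoint_ops (piz i) (pizs i)) /\
  (forall i (x : GT_label l), (1 <= i <= l.+1)%N ->
     pizs (l.+2 - i)%N (e x) = pi_zstar_ket q e i (GT_n x) (GT_h x) (GT_tab x)).

(* Labels (n,h;a,b) with a = (a_1,...,a_{l-1}) and b = (b_0,...,b_{l-1}). *)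
Definition preLambda (l : nat) : choiceType :=
  (nat * nat * (l.-1).-tuple int * l.-tuple int)%type.

Definition in_Lambda (l : nat) (x : preLambda l) : bool :=
  let: (n, h, a, b) := x in
  path <=%R 0 (rcons a n%:Z) && sorted <=%R (rcons b h%:Z).

Definition Lambda (l : nat) := {x : preLambda l | in_Lambda x}.

(* |n,h;a,b>>, set to 0 when (n,h;a,b) is not in Lambda. *)
Definition hket (R : realType) (l : nat) (K : hilbert R) (f : Lambda l -> K)
    (n h : nat) (a : (l.-1).-tuple int) (b : l.-tuple int) : K :=
  if insub ((n, h, a, b) : preLambda l) is Some x then f x else 0.

(* b_k for 0 <= k <= l, where b_l := h *)
Definition bcomp (l h : nat) (b : l.-tuple int) (k : nat) : int :=
  nth 0 (rcons b h%:Z) k.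

(* b + \underline{i} *)
Definition raise (l i : nat) (b : l.-tuple int) : l.-tuple int :=
  [tuple tnth b k + (i.-1 <= k)%N%:Z | k < l].

Definition rho_coeff (R : realType) (q : R) (l i h : nat) (b : l.-tuple int) : R :=
  if i == 1%N then q ^ (h%:Z - bcomp h b 0)
  else q ^ (h%:Z - bcomp h b i.-1)
       * Num.sqrt (1 - q ^ (2 * (bcomp h b i.-1 - bcomp h b i.-2 + 1))).

(* [rhoz i] stands for rho(z_i), 1 <= i <= l+1.  Since h >= 0, the formula
   violates the relations at h = 0 (z_1^* kills such vectors but z_1 does not),
   so they are not imposed here either. *)
Definition rho_representation (R : realType) (q : R) (l : nat) (K : hilbert R)
    (f : Lambda l -> K) (rhoz : nat -> bounded_op K K) : Prop :=
  forall i (x : Lambda l), (1 <= i <= l.+1)%N ->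
    let: (n, h, a, b) := val x in
    rhoz i (f x) = (rho_coeff q i h b)%:C *: hket f n h.+1 a (raise i b).

Definition a_of (l h : nat) (r : array l) : (l.-1).-tuple int :=
  [tuple entry r (l - j) 1 - h%:Z | j < l.-1]. (* a_{j+1} = r_{l-j,1} - h *)

Definition b_of (l h : nat) (r : array l) : l.-tuple int :=
  [tuple h%:Z - entry r (l.+1 - k) k.+1 | k < l].

Definition W_isometry (R : realType) (l : nat) (H K : hilbert R)
    (e : GT_label l -> H) (f : Lambda l -> K)
    (W : bounded_op H K) (Ws : bounded_op K H) : Prop :=
  [/\ forall x : GT_label l,
        W (e x) = hket f (GT_n x) (GT_h x)
                    (a_of (GT_h x) (GT_tab x)) (b_of (GT_h x) (GT_tab x)),
      adjoint_ops W Ws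
    & forall v : H, Ws (W v) = v].

(* Main.v *)
From HB Require Import structures.
Require Import Defs.
From mathcomp Require Import zify ring.

Set Implicit Arguments.
Unset Strict Implicit.
Unset Printing Implicit Defensive.

(* Interlacing forces row k of a tableau to be (A_k, h, ..., h, B_k) with
   A_k >= h >= B_k for k <= l, and a target r^(m) is a tableau only if every m_k points to
   the first or to the last entry of its row.  Up to a bounded factor,
   |[x]| is q^(-|x|), so |C_q| is a power of q whose exponent is computed from
   the distances between entries of consecutive rows.  Twice this exponent is
   a sum of nonnegative contributions, one for each pair (m_k, m_{k+1}), and it
   is at least 2h when m_1 = l+1 unless every m_k is the last entry; for m_1 = 1
   the factor q^h is already in the prefactor.  In the exceptional term each
   [x] is q^(-x) (1 - q^(2x)) up to a constant: the powers of q collapse to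
   q^(B_i), the factor 1 - q^(2(B_{i+1} - B_i)) gives the weight of rho, and
   the remaining factors are 1 + O(q^(h - B_i)).  Each m thus yields one
   weighted shift, built as a strongly convergent series over the basis. *)

(* [lia] spends most of its time on the hypotheses about reals. *)
Ltac zlia := try (match goal with K : realType |- _ => clear dependent K end); lia.

(** * Weighted shifts in a Hilbert space *)

Section HilbertBasis.
Variables (R : realType) (H : hilbert R).
Local Notation C := R[i].

Lemma hdotC (u v : H) : hdot u v = (hdot v u)^*%C.
Proof. by rewrite hermC expr0 mul1r. Qed.

Lemma hdot_normD (u v : H) : hdot u v = 0 ->
  `|u + v| ^+ 2 = `|u| ^+ 2 + `|v| ^+ 2.
Proof. by move=> uv0; rewrite -!hdot_norm hnormDd. Qed.

Variables (I : choiceType) (e : I -> H).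
Hypothesis he : orthonormal_basis e.

Lemma basis_dot x y : hdot (e x) (e y) = (x == y)%:R.
Proof. exact: he.1. Qed.

Lemma basis_neq0 x : e x != 0.
Proof.
apply/eqP => ex0; have := basis_dot x x.
by rewrite ex0 linear0l eqxx => /eqP; rewrite eq_sym oner_eq0.
Qed.

Lemma basis_ind (P : set H) : closed P ->
  (forall x, P (e x)) -> P 0 ->
  (forall (a : C) (u v : H), P u -> P v -> P (a *: u + v)) -> forall v, P v.
Proof.
move=> Pc Pe P0 Pl v; apply: Pc => B Bv.
have : [set: H] v by [].
rewrite -he.2 => /(_ B Bv) [w [[s [c ->]] Bw]].
exists (\sum_(x <- s) c x *: e x); split=> //.
elim: s {Bw} => [|x s IH]; first by rewrite big_nil.
by rewrite big_cons; apply: Pl.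
Qed.

(** If [u] is nonzero, density gives a finite combination [w] with [|u - w| < |u|]; but [u] is
    orthogonal to [w], so Pythagoras gives [|u - w| >= |u|]. *)
Lemma basis_total (u : H) : (forall y, hdot u (e y) = 0) -> u = 0.
Proof.
move=> u0; apply/eqP; apply: contraT => un0.
have nu : 0 < `|u| by rewrite normr_gt0.
have : [set: H] u by [].
rewrite -he.2 => /(_ _ (nbhsx_ballx u _ nu)) [w [[s [c wE]]]].
rewrite -ball_normE /=; apply: contraTT => _.
have ow : hdot u (- w) = 0.
  rewrite wE linearNr linear_sumr big1 ?oppr0// => x _.
  by rewrite linearZr_LR/= u0 mulr0.
rewrite -real_leNgt ?normr_real//.
rewrite -(@ler_pXn2r _ 2)// ?nnegrE ?normr_ge0//.
by rewrite hdot_normD// lerDl exprn_ge0.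
Qed.

Lemma basis_eq (u v : H) : (forall y, hdot u (e y) = hdot v (e y)) -> u = v.
Proof.
move=> uv; apply/eqP; rewrite -subr_eq0; apply/eqP/basis_total => y.
by rewrite linearBl/= uv subrr.
Qed.

(** Linearity and continuity are separate hypotheses on plain functions, so that the lemma applies
    to differences and sums of operators that are not packaged as [bounded_op]. *)
Lemma eq_on_basis (K : hilbert R) (f g : H -> K) : linear f -> linear g ->
  continuous f -> continuous g -> (forall x, f (e x) = g (e x)) -> f =1 g.
Proof.
move=> fl gl fc gc fg; apply: basis_ind => //; last 2 first.
- have lin0 (k : H -> K) : linear k -> k 0 = 0.
    by move=> kl; rewrite -[0 in LHS](addr0 0) -{1}(scaler0 _ (-1)) kl scaleN1r addNr.
  by rewrite !lin0.
- by move=> a u v fu fv; rewrite fl gl fu fv.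
rewrite (_ : (fun x => _) = (f \- g) @^-1` [set 0]); last first.
  by apply/seteqP; split=> x /=; [move=> ->; rewrite subrr|move/subr0_eq].
apply: preimage_closed; last first.
  exact: (accessible_closed_set1 (hausdorff_accessible (@norm_hausdorff _ _))).
by move=> x _; apply: cvgB; [exact: fc|exact: gc].
Qed.

Lemma ortho_sum_norm (J : eqType) (s : seq J) (F : J -> I) (a : J -> C) :
  uniq [seq F j | j <- s] ->
  `|\sum_(j <- s) a j *: e (F j)| ^+ 2 = \sum_(j <- s) `|a j| ^+ 2.
Proof.
elim: s => [|j s IH] /=; first by rewrite !big_nil normr0 expr0n.
case/andP => js us; rewrite !big_cons hdot_normD; last first.
  rewrite linear_sumr big_seq big1// => k ks.
  rewrite linearZr_LR linearZl_LR/= basis_dot.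
  case: eqP => [E|]; last by rewrite !mulr0.
  by move: js; rewrite E map_f.
rewrite IH// -[X in X + _]hdot_norm dnormZ basis_dot eqxx mulr1//.
Qed.

Lemma bessel (s : seq I) (v : H) : uniq s ->
  \sum_(x <- s) `|hdot v (e x)| ^+ 2 <= `|v| ^+ 2.
Proof.
move=> us; pose p := \sum_(x <- s) hdot v (e x) *: e x.
have pn : `|p| ^+ 2 = \sum_(x <- s) `|hdot v (e x)| ^+ 2.
  by rewrite (@ortho_sum_norm _ s id)// map_id.
have ox x : x \in s -> hdot (v - p) (e x) = 0.
  move=> xs; rewrite linearBl /p linear_sumlz (big_rem x)//= linearZl_LR/= basis_dot.
  rewrite eqxx mulr1 big_seq big1 ?addr0 ?subrr// => y.
  rewrite mem_rem_uniq// inE => /andP[/negPf yx _].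
  by rewrite linearZl_LR/= basis_dot yx mulr0.
have op : hdot (v - p) p = 0.
  rewrite {2}/p linear_sumr big_seq big1// => x xs.
  by rewrite linearZr_LR/= ox ?mulr0.
by rewrite -pn -[X in _ <= `|X| ^+ 2](subrK p) hdot_normD// lerDr exprn_ge0.
Qed.

(** The uniform bound [M] makes the set of vectors on which [P n] converges closed; it is a subspace
    containing the basis, hence everything. The same bound makes the limit continuous. *)
Lemma strong_limit_op (P : nat -> {linear H -> H}) (M : C) : 0 <= M ->
  (forall n v, `|P n v| <= M * `|v|) ->
  (forall x, cvg (P n (e x) @[n --> \oo])) ->
  exists T : bounded_op H H, forall v, P n v @[n --> \oo] --> T v.
Proof.
move=> M0 PM Pe.
have Pcvg v : cvg (P n v @[n --> \oo]).
  move: v; apply: basis_ind => //; last 2 first.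
  - rewrite (_ : (fun n => _) = fun=> 0); first exact: is_cvg_cst.
    by apply/funext => n; rewrite linear0.
  - move=> a u v Pu Pv; rewrite (_ : (fun n => _) = (fun n => a *: P n u + P n v)).
      by apply: is_cvgD => //; apply: is_cvgZl_tmp.
    by apply/funext => n; rewrite linearP.
  move=> v clv; apply/cauchy_cvgP/cauchy_exP => eps eps0.
  have M1 : 0 < M + 1 by rewrite ltr_wpDl.
  (* Half of [eps] is for the convergence at [w], half for [M * |w - v|]; [M + 1] keeps the quotient
     meaningful when [M] is 0. *)
  have d0 : 0 < eps / 2 / (M + 1) by rewrite !divr_gt0.
  have [w [/= Pw vw]] := clv _ (nbhsx_ballx v _ d0).
  exists (lim (P n w @[n --> \oo])).
  have e20 : 0 < eps / 2 by rewrite divr_gt0.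
  move/cvgrPdist_lt: Pw => /(_ _ e20); apply: filterS => n.
  rewrite -ball_normE /= => nw.
  rewrite [X in X < _](_ : _ = `|(lim (P k w @[k --> \oo]) - P n w) + P n (w - v)|); last first.
    by rewrite linearB /= addrA subrK.
  apply: le_lt_trans (ler_normD _ _) _.
  rewrite [X in _ < X](splitr eps); apply: ltr_leD => //.
  apply: le_trans (PM _ _) _.
  move: vw; rewrite -ball_normE /= distrC ltr_pdivlMr// => /ltW.
  apply: le_trans; rewrite mulrC ler_wpM2l// lerDl//.
pose T v := lim (P n v @[n --> \oo]).
have Tl : linear T.
  move=> a u v; rewrite /T; apply: cvg_lim => //.
  rewrite (_ : (fun n => _) = (fun n => a *: P n u + P n v)).
    by apply: cvgD; [apply: cvgZl_tmp; exact: Pcvg|exact: Pcvg].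
  by apply/funext => n; rewrite linearP.
pose TL : {linear H -> H} := HB.pack T (GRing.isLinear.Build _ _ _ _ T Tl).
have TLc : continuous TL.
  apply: bounded_linear_continuous; apply/bounded_funP => r.
  exists (1 + M * r) => v vr.
  have /cvgrPdist_lt /(_ _ ltr01) [n _ /(_ n (leqnn n)) /= Tn] := Pcvg v.
  rewrite -[X in `|X|](subrK (P n v)); apply: le_trans (ler_normD _ _) _.
  by apply: lerD; [exact: ltW|apply: le_trans (PM _ _) _; rewrite ler_wpM2l].
by exists (BoundedOp TLc) => v; exact: Pcvg.
Qed.

End HilbertBasis.

Section WeightedShift.
Variables (R : realType) (H : hilbert R) (I : countType) (e : I -> H).
Local Notation C := R[i].
Hypothesis he : orthonormal_basis e.
Variables (sigma : I -> option I) (d : I -> C) (M : R).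
Hypothesis sigma_inj : forall y y' x, sigma y = Some x -> sigma y' = Some x -> y = y'.
Hypothesis M_ge0 : 0 <= M.
Hypothesis d_le : forall y, `|d y| <= M%:C.

(** The shift is given by rows: [sigma y] is the column of the only possible nonzero entry of row
    [y], and [d y] is that entry. This suits an operator known through the action of its adjoint on
    [e y]. *)
Let wcoef (v : H) (y : I) : C := if sigma y is Some x then d y * hdot v (e x) else 0.

Let wenum n : seq I := pmap (@pickle_inv I) (iota 0 n).

Let wsum n (v : H) : H := \sum_(y <- wenum n) wcoef v y *: e y.

Let wenum_uniq n : uniq (wenum n).
Proof. by apply: (pmap_uniq (@pickle_invK I)); exact: iota_uniq. Qed.

Let mem_wenum n y : (pickle y < n)%N -> y \in wenum n.
Proof.
move=> yn; rewrite mem_pmap; apply/mapP; exists (pickle y); rewrite ?mem_iota//.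
by rewrite pickleK_inv.
Qed.

Let wsum_linear n : linear (wsum n).
Proof.
move=> a u v; rewrite /wsum scaler_sumr -big_split /=; apply: eq_bigr => y _.
rewrite scalerA -scalerDl; congr (_ *: _); rewrite /wcoef.
case: (sigma y) => [x|]; last by rewrite mulr0 addr0.
by rewrite linearPl /= mulrDr mulrCA.
Qed.

(** Injectivity of [sigma] makes the columns met by the partial sum pairwise distinct, so Bessel's
    inequality bounds their coefficients. *)
Let wsum_le n v : `|wsum n v| <= M%:C * `|v|.
Proof.
have MC : 0 <= M%:C by rewrite ler0c.
rewrite -(@ler_pXn2r _ 2)// ?nnegrE ?mulr_ge0// exprMn.
rewrite (@ortho_sum_norm _ _ _ _ he _ (wenum n) id) ?map_id//.
pose s := pmap sigma (wenum n).
have us : uniq s.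
  rewrite /s; elim: (wenum n) (wenum_uniq n) => //= y r IH /andP[yr ur].
  case E: (sigma y) => [x|]; last exact: IH.
  rewrite /= IH// andbT mem_pmap; apply/mapP => -[y' y'r E'].
  by move: yr; rewrite (sigma_inj E (esym E')) y'r.
apply: (@le_trans _ _ (M%:C ^+ 2 * \sum_(x <- s) `|hdot v (e x)| ^+ 2)); last first.
  by rewrite ler_wpM2l ?exprn_ge0// bessel.
rewrite /s; elim: (wenum n) => [|y r IH]; first by rewrite !big_nil mulr0.
rewrite big_cons /= {1}/wcoef; case: (sigma y) => [x|] /=; last first.
  by rewrite normr0 expr0n add0r.
rewrite big_cons mulrDr lerD// normrM exprMn ler_wpM2r ?exprn_ge0//.
by rewrite ler_pXn2r ?nnegrE.
Qed.

(** On a basis vector the partial sums are eventually constant, so their convergence there needs no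
    estimate. *)
Let wsum_near x y : sigma y = Some x ->
  \forall n \near \oo, wsum n (e x) = d y *: e y.
Proof.
move=> yx; exists (pickle y).+1 => // n /= yn.
rewrite /wsum (big_rem y) ?mem_wenum//= big_seq big1 ?addr0.
  by rewrite /wcoef yx basis_dot// eqxx mulr1.
move=> z; rewrite mem_rem_uniq// inE => /andP[zy _].
rewrite /wcoef; case E: (sigma z) => [x'|]; last by rewrite scale0r.
rewrite basis_dot//; case: eqP => [xx'|]; last by rewrite mulr0 scale0r.
by move: zy; rewrite xx' in yx; rewrite (sigma_inj E yx) eqxx.
Qed.

Let wsum0 n x : (forall y, sigma y <> Some x) -> wsum n (e x) = 0.
Proof.
move=> sx; rewrite /wsum big1// => y _; rewrite /wcoef.
case E: (sigma y) => [x'|]; last by rewrite scale0r.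
rewrite basis_dot//; case: eqP => [xx'|]; last by rewrite mulr0 scale0r.
by case: (sx y); rewrite xx'.
Qed.

Lemma weighted_shift : exists T : bounded_op H H,
  (forall x y, sigma y = Some x -> T (e x) = d y *: e y) /\
  (forall x, (forall y, sigma y <> Some x) -> T (e x) = 0).
Proof.
pose P n : {linear H -> H} :=
  HB.pack (wsum n) (GRing.isLinear.Build _ _ _ _ (wsum n) (wsum_linear n)).
have limS x y : sigma y = Some x -> P n (e x) @[n --> \oo] --> d y *: e y.
  by move=> yx; apply: cvg_near_cst; exact: wsum_near.
have lim0 x : (forall y, sigma y <> Some x) -> P n (e x) @[n --> \oo] --> (0 : H).
  by move=> sx; apply: cvg_near_cst; apply: nearW => n; exact: wsum0.
have [|n v|x|T PT] := @strong_limit_op _ _ _ _ he P M%:C; rewrite ?ler0c//.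
  exact: wsum_le.
  have [[y yx]|sx] := pselect (exists y, sigma y = Some x).
    by apply/cvg_ex; exists (d y *: e y); exact: limS.
  by apply/cvg_ex; exists (0 : H); apply: lim0 => y yx; apply: sx; exists y.
exists T; split=> [x y yx|x sx].
  exact: (cvg_unique (@norm_hausdorff _ _) (PT _) (limS _ _ yx)).
exact: (cvg_unique (@norm_hausdorff _ _) (PT _) (lim0 _ sx)).
Qed.

Lemma weighted_shift_entry (T : bounded_op H H) :
  (forall x y, sigma y = Some x -> T (e x) = d y *: e y) ->
  (forall x, (forall y, sigma y <> Some x) -> T (e x) = 0) ->
  forall y x, hdot (T (e x)) (e y) = if sigma y == Some x then d y else 0.
Proof.
move=> TS T0 y x; case: eqP => [yx|yx].
  by rewrite (TS _ _ yx) linearZl_LR /= basis_dot// eqxx mulr1.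
have [[z zx]|sx] := pselect (exists z, sigma z = Some x).
  rewrite (TS _ _ zx) linearZl_LR /= basis_dot//; case: eqP => [zy|].
    by case: yx; rewrite -zy.
  by rewrite mulr0.
by rewrite T0 ?linear0l// => z zx; apply: sx; exists z.
Qed.

Lemma weighted_shift_shift (T : bounded_op H H) :
  (forall y x, hdot (T (e x)) (e y) = if sigma y == Some x then d y else 0) ->
  shift_operator e T.
Proof.
move=> TE; rewrite /shift_operator /mx_entry.
have TN y x : hdot (T (e x)) (e y) != 0 -> sigma y = Some x.
  by rewrite TE; case: (sigma y =P Some x) => //; rewrite eqxx.
split=> [x y y' /TN s1 /TN s2|y x x' /TN s1 /TN s2]; first exact: sigma_inj s1 s2.
by move: s2; rewrite s1 => -[].
Qed.

End WeightedShift.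

(** * q-numbers *)

Section QNumbers.
Variables (R : realType) (q : R).
Hypothesis hq : 0 < q < 1.

Lemma q_gt0 : 0 < q. Proof. by case/andP: hq. Qed.
Lemma q_neq0 : q != 0. Proof. exact: lt0r_neq0 q_gt0. Qed.
Lemma qz_gt0 (z : int) : 0 < q ^ z. Proof. exact: exprz_gt0 q_gt0. Qed.
Lemma qz_ge0 (z : int) : 0 <= q ^ z. Proof. exact/ltW/qz_gt0. Qed.
Lemma qzD (a b : int) : q ^ (a + b) = q ^ a * q ^ b.
Proof. exact: expfzDr q_neq0. Qed.

Lemma qz_le (a b : int) : a <= b -> q ^ b <= q ^ a.
Proof.
move=> ab; rewrite -(subrK a b) qzD ger_pMl ?qz_gt0//.
have -> : b - a = `|b - a|%N by lia.
by rewrite -exprnP exprn_ile1 ?(ltW q_gt0)//; case/andP: hq => _ /ltW.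
Qed.

Lemma qz_le1 (a : int) : 0 <= a -> q ^ a <= 1.
Proof. by move=> a0; rewrite -[X in _ <= X](expr0z q); exact: qz_le. Qed.

Lemma qhalfD (a b : int) : qhalf q (a + b) = qhalf q a * qhalf q b.
Proof.
by rewrite /qhalf intrD mulrDl powRD// (negPf q_neq0) implybT.
Qed.

Lemma qhalf_double (a : int) : qhalf q (2 * a) = q ^ a.
Proof.
by rewrite /qhalf intrM mulrC mulKf// powR_intmul// ltW// q_gt0.
Qed.

Lemma qhalf_ge0 (a : int) : 0 <= qhalf q a. Proof. exact: powR_ge0. Qed.

Lemma sqrt_qz (a : int) : Num.sqrt (q ^ a) = qhalf q a.
Proof.
rewrite -qhalf_double (_ : 2 * a = a + a); last by lia.
by rewrite qhalfD -expr2 sqrtr_sqr ger0_norm ?qhalf_ge0.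
Qed.

Lemma qhalf_le (a b : int) : a <= b -> qhalf q b <= qhalf q a.
Proof. by move=> ab; rewrite -!sqrt_qz ler_wsqrtr// qz_le. Qed.

Lemma qhalf0 : qhalf q 0 = 1.
Proof. by rewrite -sqrt_qz expr0z sqrtr1. Qed.

(** What remains of [[x]] after removing $q^{-x}$ and the constant $1/(q^{-1}-q)$. It lies between
    $1-q^2$ and 1 for $x\ge1$ and vanishes at 0. *)
Definition qcomp (x : int) : R := 1 - q ^ (2 * x).

Lemma qcomp_ge (y : int) : 1 <= y -> 1 - q ^+ 2 <= qcomp y.
Proof. by move=> y1; rewrite lerD2l lerN2 -[q ^+ 2]/(q ^ 2%Z) qz_le//; lia. Qed.

Lemma q2_lt1 : 0 < 1 - q ^+ 2.
Proof. by rewrite subr_gt0 expr_lt1//; case/andP: hq => /ltW. Qed.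

Lemma qcomp_gt0 (y : int) : 1 <= y -> 0 < qcomp y.
Proof. by move=> /qcomp_ge; apply: lt_le_trans q2_lt1. Qed.

Lemma qcomp_ge0 (y : int) : 0 <= y -> 0 <= qcomp y.
Proof. by move=> y0; rewrite subr_ge0 qz_le1//; lia. Qed.

Lemma qcomp_le1 (y : int) : qcomp y <= 1.
Proof. by rewrite lerBlDr lerDl qz_ge0. Qed.

Lemma qnumE (x : int) : qnum q x = q ^ (- x) * qcomp x / (q^-1 - q).
Proof.
rewrite /qnum -[q - q^-1]opprB invrN mulrN -mulNr opprB; congr (_ / _).
by rewrite /qcomp mulrBr mulr1 -qzD (_ : - x + 2 * x = x)//; lia.
Qed.

Lemma qdiff_gt0 : 0 < q^-1 - q.
Proof.
case/andP: hq => q0 q1; rewrite subr_gt0 (lt_trans q1)// invf_gt1//.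
Qed.

Lemma qnum_ratio (x y : int) :
  qnum q x / qnum q y = q ^ (y - x) * (qcomp x / qcomp y).
Proof.
rewrite !qnumE invf_div mulrA divfK ?lt0r_neq0 ?qdiff_gt0// invfM mulrACA.
by rewrite addrC qzD invr_expz opprK.
Qed.

(** The second summand bounds $[x]\,q^{|x|}$, the third bounds its inverse, and 1 makes powers of
    the constant increasing. *)
Definition qbound : R := 1 + (q^-1 - q)^-1 + q^-1.

Lemma qbound_ge1 : 1 <= qbound.
Proof.
by rewrite /qbound -addrA lerDl addr_ge0// invr_ge0 ltW ?qdiff_gt0 ?q_gt0.
Qed.

Lemma qnumN (x : int) : qnum q (- x) = - qnum q x.
Proof. by rewrite /qnum opprK -mulNr opprB. Qed.

Lemma qnum_norm (x : int) : `|qnum q x| = qnum q `|x|.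
Proof.
have pos (y : int) : 0 <= y -> 0 <= qnum q y.
  move=> y0; rewrite qnumE divr_ge0 ?mulr_ge0 ?qz_ge0 ?qcomp_ge0//.
  exact/ltW/qdiff_gt0.
have [x0|x0] := lerP 0 x; first by rewrite !ger0_norm// pos.
by rewrite -[x in qnum q x]opprK qnumN normrN (ltr0_norm x0) ger0_norm// pos; lia.
Qed.

Lemma qnum_ge0 (x : int) : 0 <= x -> 0 <= qnum q x.
Proof. by move=> x0; rewrite -[x]ger0_norm// -qnum_norm. Qed.

Lemma qnum_le (x : int) : `|qnum q x| <= qbound * q ^ (- `|x|).
Proof.
rewrite qnum_norm qnumE -mulrA [leLHS]mulrC ler_wpM2r ?qz_ge0//.
apply: (@le_trans _ _ ((q^-1 - q)^-1)).
  by rewrite ger_pMl ?invr_gt0 ?qdiff_gt0// qcomp_le1.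
by rewrite /qbound [1 + _]addrC -addrA lerDl addr_ge0// invr_ge0 ltW// q_gt0.
Qed.

Lemma qnumV_le (x : int) : `|(qnum q x)^-1| <= qbound * q ^ `|x|.
Proof.
(* [[0]] is 0 and its inverse is 0 by convention, so vanishing denominators satisfy the bound as
   well. *)
have [->|x0] := eqVneq x 0.
  by rewrite /qnum oppr0 subrr mul0r invr0 normr0 mulr_ge0 ?qz_ge0// (le_trans _ qbound_ge1).
rewrite normfV qnum_norm qnumE.
have x1 : 1 <= `|x| by lia.
rewrite !invfM invrK invr_expz opprK -mulrA [leRHS]mulrC ler_wpM2l ?qz_ge0//.
rewrite mulrC ler_pdivrMr ?qcomp_gt0//.
apply: (@le_trans _ _ (q^-1 * (1 - q ^+ 2))).
  by rewrite mulrBr mulr1 exprSr expr1 mulrA mulVf ?q_neq0// mul1r.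
apply: ler_pM => //; rewrite ?invr_ge0 ?(ltW q_gt0) ?(ltW q2_lt1)//.
  rewrite /qbound lerDr addr_ge0// invr_ge0; exact/ltW/qdiff_gt0.
exact: qcomp_ge.
Qed.

(** Since [K >= 1], the constant can be [K ^+ N] for any bound [N] on the number of factors, hence
    uniform in the row. *)
Lemma prod_norm_le (s : seq nat) (P : pred nat) (F : nat -> R) (E : nat -> int) (K : R)
    (N : nat) : 1 <= K -> (size s <= N)%N ->
  (forall j, j \in s -> P j -> `|F j| <= K * q ^ E j) ->
  `|\prod_(j <- s | P j) F j| <= K ^+ N * q ^ (\sum_(j <- s | P j) E j).
Proof.
move=> K1 sN FE; have K0 : 0 <= K by apply: le_trans K1.
apply: (@le_trans _ _ (K ^+ size s * q ^ (\sum_(j <- s | P j) E j))); last first.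
  by rewrite ler_wpM2r ?qz_ge0// ler_weXn2l.
elim: s {sN} FE => [|j s IH] FE; first by rewrite !big_nil expr0z expr0 normr1 mulr1.
have IHs := IH (fun k ks => FE k (@mem_behead _ (j :: s) k ks)).
rewrite !big_cons /=; case: ifP => Pj.
  rewrite normrM qzD exprS mulrACA; apply: ler_pM => //.
  by apply: FE => //; rewrite inE eqxx.
apply: le_trans IHs _; rewrite ler_wpM2r ?qz_ge0// exprS ler_peMl//.
by rewrite exprn_ge0.
Qed.

Lemma prod_qz (s : seq nat) (E : nat -> int) :
  \prod_(j <- s) q ^ E j = q ^ (\sum_(j <- s) E j).
Proof.
elim: s => [|j s IH]; first by rewrite !big_nil expr0z.
by rewrite !big_cons IH qzD.
Qed.

Lemma prod_qnum_ratio (s : seq nat) (x y : nat -> int) :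
  \prod_(j <- s) (qnum q (x j) / qnum q (y j)) =
    q ^ (\sum_(j <- s) (y j - x j)) * \prod_(j <- s) (qcomp (x j) / qcomp (y j)).
Proof. by rewrite -prod_qz -big_split /=; apply: eq_bigr => j _; exact: qnum_ratio. Qed.

Lemma qnum_ratio_le (x y : int) :
  `|qnum q x / qnum q y| <= qbound ^+ 2 * q ^ (`|y| - `|x|).
Proof.
by rewrite normrM addrC qzD expr2 mulrACA ler_pM// ?qnum_le ?qnumV_le.
Qed.

(** The sign of [x] is free: the root of a negative number is 0, so a bound on the absolute value
    controls the roots in [Cq] for every [m]. *)
Lemma sqrt_le (x K : R) (z : int) : 0 <= K -> `|x| <= K * q ^ z ->
  Num.sqrt x <= Num.sqrt K * qhalf q z.
Proof.
move=> K0 xK; rewrite -sqrt_qz -sqrtrM//; apply: ler_wsqrtr.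
exact: le_trans (ler_norm _) xK.
Qed.

End QNumbers.

(** * Errors of relative size eps *)

Section NearOne.
Variables (R : realType) (eps : R).
Hypothesis eps01 : 0 <= eps <= 1.

(** As [eps <= 1], products of errors are again of order [eps]; hence this relation is stable under
    products, square roots and inverses of numbers bounded below, with explicit constants. It is
    used with [eps] equal to $q^{gap}$. *)
Definition near1 (C x : R) := `|x - 1| <= C * eps.

Lemma near1_1 : near1 0 1. Proof. by rewrite /near1 subrr normr0 mul0r. Qed.

Lemma near1_ge0 C x : 0 <= C -> near1 C x -> `|x| <= 1 + C.
Proof.
move=> C0 xC; rewrite -[x](subrK 1) addrC; apply: le_trans (ler_normD _ _) _.
rewrite normr1 lerD2l; apply: le_trans xC _; rewrite ler_piMr//.
by case/andP: eps01.
Qed.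

Lemma near1M C D x y : 0 <= C -> near1 C x -> near1 D y ->
  near1 (C + (1 + C) * D) (x * y).
Proof.
move=> C0 xC yD; rewrite /near1.
rewrite (_ : x * y - 1 = (x - 1) + x * (y - 1)); last by ring.
apply: le_trans (ler_normD _ _) _; rewrite mulrDl; apply: lerD => //.
by rewrite normrM -mulrA ler_pM// near1_ge0.
Qed.

Lemma near1V C x c : 0 < c -> c <= x -> near1 C x -> near1 (C / c) x^-1.
Proof.
move=> c0 cx xC; have x0 : 0 < x by exact: lt_le_trans cx.
rewrite /near1 (_ : x^-1 - 1 = - ((x - 1) / x)); last first.
  by rewrite mulrBl divff ?mul1r ?opprB// lt0r_neq0.
rewrite normrN normrM normfV (gtr0_norm x0) mulrAC ler_pM ?invr_ge0 ?(ltW x0)//.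
by rewrite lef_pV2.
Qed.

Lemma near1_le C D x : C <= D -> near1 C x -> near1 D x.
Proof. by move=> CD; move/le_trans; apply; rewrite ler_wpM2r//; case/andP: eps01. Qed.

(** The constant is what [near1M] yields by iteration: one plus the constant is multiplicative. *)
Lemma near1_prod (s : seq nat) (F : nat -> R) C N : 0 <= C -> (size s <= N)%N ->
  (forall j, j \in s -> near1 C (F j)) ->
  near1 ((1 + C) ^+ N - 1) (\prod_(j <- s) F j).
Proof.
move=> C0 sN Fj; apply: (@near1_le ((1 + C) ^+ size s - 1)).
  by rewrite lerD2r ler_weXn2l// lerDl.
elim: s {sN} Fj => [|j s IH] Fj.
  by rewrite big_nil expr0 subrr; exact: near1_1.
have IHs : near1 ((1 + C) ^+ size s - 1) (\prod_(j <- s) F j).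
  by apply: IH => k ks; apply: Fj; rewrite inE ks orbT.
rewrite big_cons /= exprS.
have -> : (1 + C) * (1 + C) ^+ size s - 1 = C + (1 + C) * ((1 + C) ^+ size s - 1).
  by ring.
by apply: near1M => //; apply: Fj => //; rewrite inE eqxx.
Qed.

(** In $x-1=(\sqrt x-1)(\sqrt x+1)$ the second factor is at least 1. *)
Lemma near1_sqrt C x : 0 <= x -> near1 C x -> near1 C (Num.sqrt x).
Proof.
move=> x0; apply: le_trans.
have -> : x - 1 = (Num.sqrt x - 1) * (Num.sqrt x + 1).
  by rewrite -subr_sqr sqr_sqrtr// expr1n.
rewrite normrM ler_peMr// ger0_norm ?addr_ge0 ?sqrtr_ge0//.
by rewrite lerDr sqrtr_ge0.
Qed.

Lemma near1_qcomp (q : R) (x : int) : 0 < q < 1 -> q ^ (2 * x) <= eps -> near1 1 (qcomp q x).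
Proof.
by move=> hq xe; rewrite /near1 /qcomp addrAC subrr add0r normrN mul1r ger0_norm ?qz_ge0.
Qed.

Lemma near1_qcomp_ratio (q : R) (x y : int) : 0 < q < 1 ->
  q ^ (2 * x) <= eps -> 1 <= y -> q ^ (2 * y) <= eps ->
  near1 (1 + 2 * (1 - q ^+ 2)^-1) (qcomp q x / qcomp q y).
Proof.
move=> hq xe y1 ye; rewrite [X in near1 (_ + X * _)](_ : _ = 1 + 1)// -[(1 - _)^-1]mul1r.
apply: near1M => //; first exact: near1_qcomp.
by apply: near1V; [exact: q2_lt1|exact: qcomp_ge|exact: near1_qcomp].
Qed.

End NearOne.

(** * Gelfand-Tsetlin tableaux *)

Section Tableaux.
Variable l : nat.

Lemma cell_exists (a b : nat) : (0 < a)%N -> (0 < b)%N -> (a + b <= l.+2)%N ->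
  exists c : cell l, cell_row c = a /\ cell_col c = b.
Proof.
move=> a0 b0 ab.
have al : (a < l.+2)%N by lia.
have bl : (b < l.+2)%N by lia.
have P : [&& 0 < (Ordinal al, Ordinal bl).1, 0 < (Ordinal al, Ordinal bl).2 &
   (Ordinal al, Ordinal bl).1 + (Ordinal al, Ordinal bl).2 <= l.+2]%N.
  by rewrite /= a0 b0.
by exists (exist _ (Ordinal al, Ordinal bl) P).
Qed.

Lemma entry_cell (r : array l) (c : cell l) :
  entry r (cell_row c) (cell_col c) = r c.
Proof.
rewrite /entry; case: pickP => [c' /andP[/eqP r1 /eqP r2]|/(_ c)]; last by rewrite !eqxx.
congr (r _); apply: val_inj.
move: r1 r2; rewrite /cell_row /cell_col.
by case: (val c') (val c) => [c1 c2] [d1 d2] /= /ord_inj -> /ord_inj ->.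
Qed.

Lemma cell_range (c : cell l) :
  [/\ (0 < cell_row c)%N, (0 < cell_col c)%N & (cell_row c + cell_col c <= l.+2)%N].
Proof. by move: (valP c); rewrite /cell_row /cell_col => /and3P[]. Qed.

Lemma entry_inj (r r' : array l) :
  (forall a b, (0 < a)%N -> (0 < b)%N -> (a + b <= l.+2)%N ->
     entry r a b = entry r' a b) -> r = r'.
Proof.
move=> rr; apply/ffunP => c; rewrite -!entry_cell.
by have [] := cell_range c; exact: rr.
Qed.

Lemma entry_shift i (r : array l) (m : i.-tuple 'I_l.+2) a b :
  (0 < a)%N -> (0 < b)%N -> (a + b <= l.+2)%N ->
  entry (shift_array r m) a b =
    entry r a b - (mcomp m 1 == l.+1)%:Z + ((a <= i)%N && (b == mcomp m a))%:Z.
Proof.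
move=> a0 b0 ab; have [c [<- <-]] := cell_exists a0 b0 ab.
by rewrite !entry_cell ffunE.
Qed.

Lemma mcomp_Gamma i (m : i.-tuple 'I_l.+2) k : in_Gamma m -> (1 <= k <= i)%N ->
  (1 <= mcomp m k <= l.+2 - k)%N.
Proof.
move=> /forallP mG /andP[k1 ki].
have ki' : (k.-1 < i)%N by lia.
have := mG (Ordinal ki'); rewrite (tnth_nth ord0) /mcomp /=; lia.
Qed.

(** $A_k$ and, next, $B_k$: the ends of row $k$, which coincide in the one-entry row $l+1$. *)
Definition Aent (r : array l) (k : nat) : int := entry r k 1.
Definition Bent (r : array l) (k : nat) : int := entry r k (l.+2 - k).

Section Label.
Variables (n h : nat) (r : array l).
Hypothesis rP : is_GT_label (n, h, r).

Lemma label_interlace a b : (0 < a)%N -> (0 < b)%N -> (a + b <= l.+1)%N ->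
  entry r a b.+1 <= entry r a.+1 b <= entry r a b.
Proof.
move=> a0 b0 ab; case/and3P: rP => /andP[_ /forallP G] _ _.
have al : (a < l.+2)%N by lia.
have bl : (b < l.+2)%N by lia.
by have /forallP/(_ (Ordinal bl)) := G (Ordinal al); rewrite /= a0 b0 ab.
Qed.

Lemma label_11 : entry r 1 1 = (n + h)%N%:Z.
Proof. by case/and3P: rP => _ /eqP. Qed.

Lemma label_1last : entry r 1 l.+1 = 0.
Proof. by case/and3P: rP => /andP[/eqP]. Qed.

Lemma label_mid a b : (0 < a)%N -> (2 <= b)%N -> (a + b <= l.+1)%N ->
  entry r a b = h%:Z.
Proof.
elim: a b => // -[_ b _ b2 bl|a IH b _ b2 abl].
  case/and3P: rP => _ _ /forallP G.
  have bl' : (b < l.+1)%N by lia.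
  by have := G (Ordinal bl'); rewrite /= b2 => /eqP.
apply/eqP; rewrite eq_le.
have /andP[] : entry r a.+1 b.+1 <= entry r a.+2 b <= entry r a.+1 b.
  by apply: label_interlace; lia.
by rewrite !IH//; [move=> -> ->|lia|lia|lia].
Qed.

Lemma Aent_ge k : (1 <= k <= l)%N -> h%:Z <= Aent r k.
Proof.
case: k => // -[_|k kl]; rewrite /Aent; first by rewrite label_11; lia.
have /andP[+ _] : entry r k.+1 2 <= entry r k.+2 1 <= entry r k.+1 1.
  by apply: label_interlace; lia.
by rewrite label_mid//; lia.
Qed.

Lemma Bent1 : Bent r 1 = 0.
Proof. by rewrite /Bent subn1 label_1last. Qed.

Lemma Bent_le k : (1 <= k <= l)%N -> Bent r k <= h%:Z.
Proof.
case: k => // -[_|k kl]; first by rewrite Bent1.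
rewrite /Bent.
have /andP[_] : entry r k.+1 (l.+2 - k.+2).+1 <= entry r k.+2 (l.+2 - k.+2)
    <= entry r k.+1 (l.+2 - k.+2).
  by apply: label_interlace; lia.
by rewrite (@label_mid k.+1)//; lia.
Qed.

Lemma Bent_mono k : (1 <= k <= l)%N -> Bent r k <= Bent r k.+1.
Proof.
move=> kl; rewrite /Bent.
have /andP[+ _] : entry r k (l.+2 - k.+1).+1 <= entry r k.+1 (l.+2 - k.+1)
    <= entry r k (l.+2 - k.+1).
  by apply: label_interlace; lia.
by rewrite (_ : (l.+2 - k.+1).+1 = l.+2 - k)%N//; lia.
Qed.

Lemma Bent_homo k k' : (1 <= k)%N -> (k <= k' <= l.+1)%N -> Bent r k <= Bent r k'.
Proof.
move=> k1 /andP[]; elim: k' => [|k' IH]; first lia.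
rewrite leq_eqVlt => /orP[/eqP -> //|kk' kl].
by apply: le_trans (IH _ _) (Bent_mono _); lia.
Qed.

Lemma Bent_ge0 k : (1 <= k <= l.+1)%N -> 0 <= Bent r k.
Proof. by move=> kl; rewrite -Bent1; apply: Bent_homo; lia. Qed.

Lemma Aent_mono k : (1 <= k <= l)%N -> Aent r k.+1 <= Aent r k.
Proof. move=> kl; have /andP[_ //] : entry r k 2 <= entry r k.+1 1 <= entry r k 1.
by apply: label_interlace; lia. Qed.

Lemma ABent : Aent r l.+1 = Bent r l.+1.
Proof. by rewrite /Aent /Bent (_ : l.+2 - l.+1 = 1)%N//; lia. Qed.

Lemma row_sum (F : int -> int) k : (1 <= k <= l)%N ->
  \sum_(1 <= j < l.+3 - k) F (entry r k j) =
    F (Aent r k) + F h%:Z *+ (l - k) + F (Bent r k).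
Proof.
move=> kl; rewrite (_ : l.+3 - k = (l - k).+3)%N; last lia.
rewrite big_nat_recr//= big_nat_recl//= /Bent (_ : l.+2 - k = (l - k).+2)%N; last lia.
congr (_ + _ + _); rewrite [LHS](eq_big_nat _ _ (F2 := fun=> F h%:Z)).
  by rewrite sumr_const_nat subn1.
by move=> j jl; rewrite label_mid//; lia.
Qed.

Lemma last_row_sum (F : int -> int) :
  \sum_(1 <= j < l.+3 - l.+1) F (entry r l.+1 j) = F (Bent r l.+1).
Proof.
by rewrite (_ : l.+3 - l.+1 = 2)%N ?big_nat1 -?ABent//; lia.
Qed.

End Label.

(* A middle entry of a row cannot be raised: in the target tableau it would
   exceed the common value of the middle entries. *)
Lemma shift_extremal (n h n' h' : nat) (r : array l) i (m : i.-tuple 'I_l.+2) k :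
  is_GT_label (n, h, r) -> is_GT_label (n', h', shift_array r m) ->
  in_Gamma m -> h%:Z = h'%:Z + (mcomp m 1 == l.+1)%:Z -> (1 <= k <= i)%N ->
  mcomp m k = 1%N \/ mcomp m k = (l.+2 - k)%N.
Proof.
move=> rP sP mG hh kl; have := mcomp_Gamma mG kl => mk.
case: (ltnP 1 (mcomp m k)) => m1; last by left; lia.
case: (ltnP (mcomp m k) (l.+2 - k)) => m2; last by right; lia.
have := @label_mid _ _ _ sP k (mcomp m k).
rewrite entry_shift ?(@label_mid _ _ _ rP k (mcomp m k)) ?eqxx; lia.
Qed.

End Tableaux.

(** * The exponent of C_q *)

Lemma gedist (x y : int) : y <= x -> `|x - y| = x - y.
Proof. by move=> yx; rewrite ger0_norm// subr_ge0. Qed.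

Lemma ledist (x y : int) : x <= y -> `|x - y| = y - x.
Proof. by move=> xy; rewrite distrC gedist. Qed.

(* Twice the order in q of the factor of C_q attached to consecutive rows
   (A, h, ..., h, B) and (A', h, ..., h, B'), with m pointing to the entries s
   and t, minus the telescoping part s - t. *)
Definition slack (A A' B B' h : int) (N : nat) (s t : int) : int :=
  (`|A - s| + `|h - s| *+ N.+1 + `|B - s|) - (`|A - t| + `|h - t| *+ N.+1 + `|B - t|)
  + (`|A' - t| + `|h - t| *+ N + `|B' - t|) - (`|A' - s| + `|h - s| *+ N + `|B' - s|)
  + 2 * `|s - t| + t - s.

(** The four cases are the possible ends pointed to in two consecutive rows, with [N.+1] and [N]
    middle entries. All values are nonnegative; from [B], staying on the last entry costs
    [2 * (B' - B)] and leaving it at least [2 * (h - B)]. *)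
Lemma slackE (A A' B B' h : int) (N : nat) :
  B <= B' -> B' <= h -> h <= A' -> A' <= A ->
  [/\ slack A A' B B' h N A A' = 0,
      slack A A' B B' h N B B' = 2 * (B' - B),
      slack A A' B B' h N A B' = 2 * (A' - h)
    & slack A A' B B' h N B A' = 2 * (A' + h - B - B')].
Proof.
move=> BB B'h hA' AA; have Bh := le_trans BB B'h; have hA := le_trans hA' AA.
have BA' := le_trans Bh hA'; have BA := le_trans BA' AA.
have B'A' := le_trans B'h hA'; have B'A := le_trans B'A' AA.
by rewrite /slack !mulrS; split;
  rewrite !(subrr, normr0, gedist AA, ledist AA, gedist hA', ledist hA', gedist hA,
    ledist hA, gedist BB, ledist BB, gedist Bh, ledist Bh, gedist BA, ledist BA,
    gedist BA', ledist BA', gedist B'h, ledist B'h, gedist B'A, ledist B'A,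
    gedist B'A', ledist B'A'); lia.
Qed.

(* The same when the second row is the single entry X of the tip. *)
Definition slack_last (A B X s t : int) : int :=
  (`|A - s| + `|B - s|) - (`|A - t| + `|B - t|) + `|X - t| - `|X - s|
  + 2 * `|s - t| + t - s.

Lemma slack_lastE (A B X : int) : B <= X -> X <= A ->
  slack_last A B X A X = 0 /\ slack_last A B X B X = 2 * (X - B).
Proof. by move=> BX XA; rewrite /slack_last; lia. Qed.

Section Exponents.
Variables (l n h : nat) (r : array l).
Hypothesis rP : is_GT_label (n, h, r).
Variables (i : nat) (m : i.-tuple 'I_l.+2).
Hypothesis il : (1 <= i <= l.+1)%N.
Hypothesis mG : in_Gamma m.
Hypothesis mE : forall k, (1 <= k <= i)%N ->
  mcomp m k = 1%N \/ mcomp m k = (l.+2 - k)%N.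

Local Notation mm := (mcomp m).
Local Notation mz k := ((mcomp m k)%:Z).
Local Notation ss k := (entry r k (mcomp m k)).

Definition row_dist (k : nat) (x : int) : int :=
  \sum_(1 <= j < l.+3 - k) `|entry r k j - x|.

(** The order in $q$ of the first product in the [k]-th factor of [Cq_middle], each ratio $[x]/[y]$
    counting for $|y|-|x|$; [mid_exp2] and [last_exp] do the same for the other products. *)
Definition mid_exp1 (k : nat) : int :=
  \sum_(1 <= j < l.+3 - k | j != mm k)
    (`|entry r k j - ss k - j%:Z + mz k| - `|entry r k j - ss k.+1 - j%:Z + mz k.+1|).

Definition mid_exp2 (k : nat) : int :=
  \sum_(1 <= j < l.+2 - k | j != mm k.+1)
    (`|entry r k.+1 j - ss k.+1 - j%:Z + mz k.+1 - 1|
     - `|entry r k.+1 j - ss k - j%:Z + mz k - 1|).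

Definition mid_exp k := mid_exp1 k + mid_exp2 k.

Definition last_exp : int :=
  \sum_(1 <= k < l.+3 - i | k != mm i) `|entry r i k - ss i - k%:Z + mz i|
  - \sum_(1 <= k < l.+2 - i) `|entry r i.+1 k - ss i - k%:Z + mz i - 1|.

Lemma sum_int_ge (a b : nat) (P : pred nat) (F G : nat -> int) (c N : nat) :
  (b - a <= N)%N ->
  (forall j, (a <= j < b)%N -> P j -> G j - c%:Z <= F j) ->
  \sum_(a <= j < b | P j) G j - (N * c)%N%:Z <= \sum_(a <= j < b | P j) F j.
Proof.
move=> abN FG; rewrite lerBlDr.
apply: (@le_trans _ _ (\sum_(a <= j < b | P j) F j + \sum_(a <= j < b | P j) c%:Z)).
  rewrite -big_split /= [leLHS]big_nat_cond [leRHS]big_nat_cond.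
  apply: ler_sum => j /andP[/andP[ja jb] Pj].
  by rewrite -lerBlDr; apply: FG => //; rewrite ja jb.
rewrite lerD2l; apply: (@le_trans _ _ (\sum_(a <= j < b) c%:Z)).
  rewrite [leRHS](bigID P) /= lerDl; apply: sumr_ge0 => j _; lia.
by rewrite sumr_const_nat -mulr_natr natz -PoszM lez_nat mulnC leq_mul2r abN orbT.
Qed.

Lemma mm_range k : (1 <= k <= i)%N -> (1 <= mm k <= l.+2 - k)%N.
Proof. exact: mcomp_Gamma. Qed.

Lemma sum_skip (F : nat -> int) k : (1 <= k <= i)%N ->
  \sum_(1 <= j < l.+3 - k | j != mm k) F j = \sum_(1 <= j < l.+3 - k) F j - F (mm k).
Proof.
move=> ki; have mk := mm_range ki.
rewrite [in RHS](bigD1_seq (mm k)) ?iota_uniq ?mem_index_iota//=; last lia.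
by rewrite [RHS]addrC addKr.
Qed.

(** An index shift is at most [l.+3] in absolute value and each term has at most two; [row_err]
    allows two sums of at most [l.+2] terms. *)
Definition term_err : nat := (2 * l.+3)%N.
Definition row_err : nat := (2 * (l.+2 * term_err))%N.

(** Completing the sums to whole rows adds the omitted indices [mm k] and [mm k.+1]; each accounts
    for one [|ss k - ss k.+1|]. *)
Lemma mid_exp_ge k : (1 <= k < i)%N ->
  row_dist k (ss k) - row_dist k (ss k.+1)
  + row_dist k.+1 (ss k.+1) - row_dist k.+1 (ss k)
  + 2 * `|ss k - ss k.+1| - row_err%:Z <= mid_exp k.
Proof.
move=> ki; have mk := @mm_range k _; have mk' := @mm_range k.+1 _.
have E1 : \sum_(1 <= j < l.+3 - k | j != mm k)
   (`|entry r k j - ss k| - `|entry r k j - ss k.+1|) - (l.+2 * term_err)%N%:Z <= mid_exp1 k.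
  by apply: sum_int_ge => [|j jk _]; [lia|rewrite /term_err; lia].
have E2 : \sum_(1 <= j < l.+3 - k.+1 | j != mm k.+1)
   (`|entry r k.+1 j - ss k.+1| - `|entry r k.+1 j - ss k|) - (l.+2 * term_err)%N%:Z <= mid_exp2 k.
  by apply: sum_int_ge => [|j jk _]; [lia|rewrite /term_err; lia].
move: E1 E2; rewrite !sum_skip; [|lia|lia].
rewrite !sumrB -!/(row_dist _ _) /mid_exp /row_err; lia.
Qed.

Lemma row_distE k x : (1 <= k <= l)%N ->
  row_dist k x = `|Aent r k - x| + `|h%:Z - x| *+ (l - k) + `|Bent r k - x|.
Proof. by move=> kl; rewrite /row_dist (row_sum rP (fun a => `|a - x|)). Qed.

Lemma row_dist_last x : row_dist l.+1 x = `|Bent r l.+1 - x|.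
Proof. by rewrite /row_dist (last_row_sum rP (fun a => `|a - x|)). Qed.

(** In row [l.+1] the first entry is also the last; counting it as last makes the cases
    exclusive. *)
Lemma mm_cases k : (1 <= k <= i)%N ->
  (mm k = (l.+2 - k)%N /\ ss k = Bent r k) \/
  [/\ mm k = 1%N, ss k = Aent r k, (k <= l)%N & mm k != (l.+2 - k)%N].
Proof.
move=> ki; have [m1|m2] := mE ki; last by left; rewrite m2.
have [kl|kl] := leqP k l; first by right; split=> //; [rewrite m1|lia].
have e : (l.+2 - k = 1)%N by lia.
by left; rewrite /Bent e m1.
Qed.

Lemma mid_exp_cases k : (1 <= k < i)%N ->
  [/\ ss k - ss k.+1 - row_err%:Z <= mid_exp k,
      mm k = (l.+2 - k)%N -> mm k.+1 = (l.+2 - k.+1)%N ->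
      ss k - ss k.+1 + 2 * (Bent r k.+1 - Bent r k) - row_err%:Z <= mid_exp k
    & mm k = (l.+2 - k)%N -> mm k.+1 != (l.+2 - k.+1)%N ->
      ss k - ss k.+1 + 2 * (h%:Z - Bent r k) - row_err%:Z <= mid_exp k].
Proof.
move=> ki; have := mid_exp_ge ki.
have kl : (1 <= k <= l)%N by lia.
have C1 : (mm k = (l.+2 - k)%N /\ ss k = Bent r k) \/
  [/\ mm k = 1%N, ss k = Aent r k, (k <= l)%N & mm k != (l.+2 - k)%N].
  by apply: mm_cases; lia.
have C2 : (mm k.+1 = (l.+2 - k.+1)%N /\ ss k.+1 = Bent r k.+1) \/
  [/\ mm k.+1 = 1%N, ss k.+1 = Aent r k.+1, (k.+1 <= l)%N
    & mm k.+1 != (l.+2 - k.+1)%N].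
  by apply: mm_cases; lia.
(* For [k = l] the second row is the single entry of the tip, which calls for [slack_last]. *)
have [kl'|kl'] := ltnP k l.
  have kl2 : (1 <= k.+1 <= l)%N by lia.
  have E : slack (Aent r k) (Aent r k.+1) (Bent r k) (Bent r k.+1) h%:Z (l - k.+1)
      (ss k) (ss k.+1) + ss k - ss k.+1 - row_err%:Z <= mid_exp k.
    apply: le_trans (mid_exp_ge ki); rewrite !row_distE//.
    rewrite (_ : (l - k = (l - k.+1).+1)%N); last by lia.
    by rewrite le_eqVlt; apply/orP; left; apply/eqP; rewrite /slack; ring.
  have A2 := Aent_ge rP kl2; have B2 := Bent_le rP kl2.
  have BB := Bent_mono rP kl.
  have [S1 S2 S3 S4] := slackE (l - k.+1) BB B2 A2 (Aent_mono rP kl).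
  case: C1 => [[m1 s1]|[m1 s1 _ n1]]; case: C2 => [[m2 s2]|[m2 s2 _ n2]];
    rewrite -> s1, s2 in E; rewrite s1 s2 ?S1 ?S2 ?S3 ?S4 in E *;
    clear S1 S2 S3 S4 s1 s2; by split=> [|c1 c2|c1 c2]; lia.
have kE : k.+1 = l.+1 by lia.
have XA : Bent r k.+1 <= Aent r k.
  by apply: le_trans (Aent_mono rP kl); rewrite kE (ABent rP).
have E : slack_last (Aent r k) (Bent r k) (Bent r k.+1) (ss k) (ss k.+1)
    + ss k - ss k.+1 - row_err%:Z <= mid_exp k.
  apply: le_trans (mid_exp_ge ki); rewrite !(row_distE _ kl).
  rewrite kE !row_dist_last -kE (_ : l - k = 0)%N ?mulr0n ?addr0; last lia.
  by rewrite le_eqVlt; apply/orP; left; apply/eqP; rewrite /slack_last; ring.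
have BB := Bent_mono rP kl.
have [S1 S2] := slack_lastE BB XA.
case: C2 => [[m2 s2]|[_ _ ? _]]; last by lia.
case: C1 => [[m1 s1]|[m1 s1 _ n1]]; rewrite -> s1, s2 in E; rewrite s1 s2 ?S1 ?S2 in E *;
  clear S1 S2 s1 s2; by split=> [|c1 c2|c1 c2]; lia.
Qed.

Lemma last_exp_ge :
  row_dist i (ss i) - row_dist i.+1 (ss i) - row_err%:Z <= last_exp.
Proof.
have mi := @mm_range i _.
have E1 : \sum_(1 <= j < l.+3 - i | j != mm i) `|entry r i j - ss i|
    - (l.+2 * term_err)%N%:Z
  <= \sum_(1 <= k < l.+3 - i | k != mm i) `|entry r i k - ss i - k%:Z + mz i|.
  by apply: sum_int_ge => [|j jk _]; [lia|rewrite /term_err; lia].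
have E2 : \sum_(1 <= j < l.+3 - i.+1) (- `|entry r i.+1 j - ss i|)
    - (l.+2 * term_err)%N%:Z
  <= \sum_(1 <= k < l.+2 - i) (- `|entry r i.+1 k - ss i - k%:Z + mz i - 1|).
  by apply: sum_int_ge => [|j jk _]; [lia|rewrite /term_err; lia].
move: E1 E2; rewrite sum_skip; last lia.
rewrite subrr normr0 subr0 !sumrN -/(row_dist i (ss i)) -/(row_dist i.+1 (ss i)).
rewrite /last_exp /row_err.
by move: (l.+2 * term_err)%N (\sum_(_ <= _ < _ | _) _) (\sum_(_ <= _ < _) _) => N S1 S2; clear; lia.
Qed.

Lemma row_sum_but_last k : (1 <= k <= l)%N ->
  \sum_(1 <= j < l.+2 - k) entry r k j = Aent r k + h%:Z *+ (l - k).
Proof.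
move=> kl; have := row_sum rP id kl.
rewrite (_ : l.+3 - k = (l.+2 - k).+1)%N; last lia.
rewrite big_nat_recr /=; last lia.
by move=> /addIr.
Qed.

(** The sum over rows [i] and [i.+1] in [Cq_exponent] cancels the distances in [last_exp] if [ss i]
    is $B_i$, and leaves a nonnegative excess if it is $A_i$. The remaining [ss i - ss 1] cancels
    the telescoping part of the [mid_exp k]. *)
Lemma end_exp_ge :
  ss i - ss 1%N - (row_err + 2 * l.+2)%N%:Z <= Cq_exponent r m + last_exp.
Proof.
have := last_exp_ge; rewrite /Cq_exponent -/(Bent r i) sumrB.
have mi := @mm_range i _; have m1 := @mm_range 1 _.
have Ci : (mm i = (l.+2 - i)%N /\ ss i = Bent r i) \/
  [/\ mm i = 1%N, ss i = Aent r i, (i <= l)%N & mm i != (l.+2 - i)%N].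
  by apply: mm_cases; lia.
set Z := mz i; have hZ : 1 <= Z <= l.+1%:Z by rewrite /Z; lia.
set Z1 := mz 1; have hZ1 : 1 <= Z1 <= l.+1%:Z by rewrite /Z1; lia.
clear m1; set s1 := ss 1%N; move: (last_exp) => le.
have [il1|il1] := leqP i l; last first.
  have ie : (l.+2 - i = 1)%N by lia.
  have ie' : (l.+3 - i.+1 = 1)%N by lia.
  rewrite {2}/row_dist ie' ie !big_geq//.
  case: Ci => [[_ ->]|[_ _ ? _]]; last by lia.
  rewrite (_ : i = l.+1) ?row_dist_last ?subrr ?normr0; last by lia.
  rewrite (_ : l.+1 = i); last by lia.
  by clear - il il1 hZ hZ1; lia.
have il2 : (1 <= i <= l)%N by lia.
have BB := Bent_mono rP il2.
rewrite row_sum_but_last// (row_distE _ il2).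
have [il3|il3] := ltnP i l; last first.
  have XA : Bent r i.+1 <= Aent r i.
    by apply: le_trans (Aent_mono rP il2); rewrite (_ : i.+1 = l.+1) ?(ABent rP)//; lia.
  have ie : (l.+2 - i = 2)%N by lia.
  have ie' : (l - i = 0)%N by lia.
  have ile : i.+1 = l.+1 by lia.
  rewrite ie ie' ile row_dist_last -ile big_nat1 (_ : entry r i.+1 1 = Bent r i.+1); last first.
    by rewrite ile -(ABent rP).
  by case: Ci => [[_ ->]|[_ -> _ _]]; clear - BB XA hZ hZ1 il1 il2 il3; lia.
have il4 : (1 <= i.+1 <= l)%N by lia.
have AA := Aent_mono rP il2; have hA := Aent_ge rP il4; have Bh := Bent_le rP il4.
rewrite (row_distE _ il4) (_ : l.+2 - i = l.+3 - i.+1)%N; last by lia.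
rewrite (row_sum rP id il4) (_ : (l - i = (l - i.+1).+1)%N); last by lia.
rewrite !mulrS.
set a := `|_| *+ _; set b := h%:Z *+ _.
by case: Ci => [[_ ->]|[_ -> _ _]]; clear - BB AA hA Bh hZ hZ1; lia.
Qed.

Lemma mid_sum_ge i' : (1 <= i' <= i)%N ->
  ss 1%N - ss i' - (i'.-1 * row_err)%N%:Z <= \sum_(1 <= k < i') mid_exp k.
Proof.
elim: i' => // -[_ _|k IH kl]; first by rewrite big_geq// subrr.
rewrite big_nat_recr//=; have [E _ _] := @mid_exp_cases k.+1 kl.
apply: le_trans (lerD (IH (ltnW kl)) E); rewrite mulSn PoszD.
by move: (ss 1%N) (ss k.+1) (ss k.+2) => a b c; rewrite /=; move: (k * row_err)%N; clear; lia.
Qed.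

(* As long as m stays on the last entries the exponent grows by 2 B; the first
   departure raises it to 2 h, and it never decreases afterwards. *)
Lemma mid_sum_ge_last i' : mm 1 = l.+1 -> (1 <= i' <= i)%N ->
  (forall k, (1 <= k <= i')%N -> mm k = (l.+2 - k)%N) /\
    ss 1%N - ss i' + 2 * Bent r i' - (i'.-1 * row_err)%N%:Z <= \sum_(1 <= k < i') mid_exp k
  \/ ss 1%N - ss i' + 2 * h%:Z - (i'.-1 * row_err)%N%:Z <= \sum_(1 <= k < i') mid_exp k.
Proof.
move=> m1; elim: i' => // -[_ _|k IH kl].
  left; rewrite (Bent1 rP) big_geq// subrr; split=> // k kk.
  have -> : k = 1%N by lia.
  by rewrite m1; lia.
rewrite big_nat_recr//=; have [E1 E2 E3] := @mid_exp_cases k.+1 kl.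
have [[al H]|H] := IH (ltnW kl); last first.
  right; apply: le_trans (lerD H E1).
  by rewrite mulSn PoszD /=; move: (k * row_err)%N; clear; lia.
have mk : mm k.+1 = (l.+2 - k.+1)%N by apply: al; rewrite leqnn.
have [m2|m2] := eqVneq (mm k.+2) (l.+2 - k.+2)%N.
  left; split=> [k' kk'|].
    have [->//|kn] := eqVneq k' k.+2.
    by apply: al; lia.
  apply: le_trans (lerD H (E2 mk m2)).
  by rewrite mulSn PoszD /=; move: (k * row_err)%N; clear; lia.
right; apply: le_trans (lerD H (E3 mk m2)).
by rewrite mulSn PoszD /=; move: (k * row_err)%N; clear; lia.
Qed.

(* The exponents involve the shifted entries r_{k,j} - j; [exp_slack] bounds
   the total effect of dropping the shifts. *)
Definition exp_slack : nat := (l.+2 * row_err + 2 * l.+2)%N.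

Lemma exp_slack_ge : (i.-1 * row_err + (row_err + 2 * l.+2) <= exp_slack)%N.
Proof.
rewrite /exp_slack addnA leq_add2r addnC -mulSn leq_mul2r; apply/orP; right; lia.
Qed.

Lemma total_exp_ge :
  - exp_slack%:Z <= Cq_exponent r m + \sum_(1 <= k < i) mid_exp k + last_exp.
Proof.
have ii : (1 <= i <= i)%N by rewrite leqnn andbT; case/andP: il.
rewrite -addrA addrCA; apply: le_trans (lerD (mid_sum_ge ii) end_exp_ge).
by have := exp_slack_ge; move: (i.-1 * row_err)%N; clear; lia.
Qed.

Lemma total_exp_ge_last : mm 1 = l.+1 ->
  (exists2 k, (1 <= k <= i)%N & mm k <> (l.+2 - k)%N) ->
  2 * h%:Z - exp_slack%:Z <= Cq_exponent r m + \sum_(1 <= k < i) mid_exp k + last_exp.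
Proof.
have ii : (1 <= i <= i)%N by rewrite leqnn andbT; case/andP: il.
move=> m1 [k ki mk]; case: (mid_sum_ge_last m1 ii) => [[al _]|H].
  by case: mk; apply: al.
rewrite -addrA addrCA; apply: le_trans (lerD H end_exp_ge).
by have := exp_slack_ge; move: (i.-1 * row_err)%N; clear; lia.
Qed.

End Exponents.

(** * Bounds for C_q by powers of q *)

Section CqBound.
Variables (R : realType) (q : R).
Hypothesis hq : 0 < q < 1.
Variables (l i : nat) (r : array l) (m : i.-tuple 'I_l.+2).
Hypothesis il : (1 <= i <= l.+1)%N.

Definition mid_const : R := (qbound q ^+ 2) ^+ l.+2 * (qbound q ^+ 2) ^+ l.+2.
Definition last_const : R := qbound q ^+ l.+2 * qbound q ^+ l.+2.

Definition Cq_const : R := Num.sqrt (mid_const ^+ l.+1) * Num.sqrt last_const.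

Let b1 : 1 <= qbound q. Proof. exact: qbound_ge1. Qed.
Let b2 : 1 <= qbound q ^+ 2. Proof. exact: exprn_ege1. Qed.
Let mid_const_ge1 : 1 <= mid_const. Proof. by rewrite mulr_ege1// exprn_ege1. Qed.
Let last_const_ge1 : 1 <= last_const. Proof. by rewrite mulr_ege1// exprn_ege1. Qed.

Lemma Cq_middle_le : `|Cq_middle q r m|
  <= mid_const ^+ l.+1 * q ^ (\sum_(1 <= k < i) mid_exp r m k).
Proof.
apply: prod_norm_le => //; first by rewrite size_iota; lia.
move=> k ki _; rewrite normrM /mid_exp qzD// mulrACA; apply: ler_pM => //.
- apply: prod_norm_le => //; first by rewrite size_iota; lia.
  by move=> j _ _; exact: qnum_ratio_le.
- apply: prod_norm_le => //; first by rewrite size_iota; lia.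
  by move=> j _ _; exact: qnum_ratio_le.
Qed.

Lemma Cq_last_le : `|Cq_last q r m| <= last_const * q ^ last_exp r m.
Proof.
rewrite /Cq_last -prodfV normrM /last_exp addrC qzD// mulrACA; apply: ler_pM => //.
  rewrite -sumrN; apply: prod_norm_le => //; first by rewrite size_iota; lia.
  by move=> j _ _; exact: qnum_le.
apply: prod_norm_le => //; first by rewrite size_iota; lia.
by move=> j _ _; exact: qnumV_le.
Qed.

Lemma Cq_sign_le : `|Cq_sign R m| <= 1.
Proof.
rewrite /Cq_sign; elim/big_ind: _ => [|x y x1 y1|k _]; first by rewrite normr1.
  by rewrite normrM mulr_ile1.
by case: ifP; rewrite ?normrN normr1.
Qed.

(** Stated for any [E] to serve twice: with [E = 0] for $m_1=1$ and with [E] equal to $2h$ for the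
    non-exceptional terms with $m_1=l+1$. *)
Lemma Cq_le (E : int) (c : nat) :
  E - c%:Z <= Cq_exponent r m + \sum_(1 <= k < i) mid_exp r m k + last_exp r m ->
  `|Cq q r m| <= Cq_const * qhalf q (- c%:Z) * qhalf q E.
Proof.
move=> Ec; rewrite -mulrA -qhalfD//.
apply: (@le_trans _ _ (Cq_const * qhalf q
    (Cq_exponent r m + \sum_(1 <= k < i) mid_exp r m k + last_exp r m))); last first.
  rewrite ler_wpM2l ?mulr_ge0 ?sqrtr_ge0// qhalf_le//; lia.
have K0 : 0 <= mid_const by apply: le_trans mid_const_ge1.
have L0 : 0 <= last_const by apply: le_trans last_const_ge1.
rewrite (qhalfD hq _ (last_exp r m)) (qhalfD hq (Cq_exponent r m)).
rewrite /Cq !normrM [X in X * _ * _ * _ <= _]ger0_norm ?qhalf_ge0//.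
rewrite ![`|Num.sqrt _|]ger0_norm ?sqrtr_ge0//.
have M := sqrt_le hq (exprn_ge0 l.+1 K0) Cq_middle_le.
have L := sqrt_le hq L0 Cq_last_le.
apply: (@le_trans _ _ (qhalf q (Cq_exponent r m) * 1 *
   (Num.sqrt (mid_const ^+ l.+1) * qhalf q (\sum_(1 <= k < i) mid_exp r m k)) *
   (Num.sqrt last_const * qhalf q (last_exp r m)))); last first.
  by rewrite /Cq_const le_eqVlt; apply/orP; left; apply/eqP; ring.
have h0 := qhalf_ge0 q.
do 2 (apply: ler_pM; rewrite ?mulr_ge0 ?sqrtr_ge0 ?h0//).
by rewrite ler_wpM2l// Cq_sign_le.
Qed.

End CqBound.

(** * The leading coefficient *)

Lemma prod_but_last (R : comPzRingType) (F : nat -> R) (n N : nat) : (0 < n)%N -> N = n.+1 ->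
  \prod_(1 <= k < N | k != n) F k = \prod_(1 <= k < n) F k.
Proof.
move=> n0 ->; rewrite big_mkcond big_nat_recr//= eqxx mulr1.
by apply: eq_big_nat => k kn; rewrite ifT//; lia.
Qed.

Section Leading.
Variables (R : realType) (q : R).
Hypothesis hq : 0 < q < 1.
Variables (l n h n' h' : nat) (r : array l).
Hypothesis rP : is_GT_label (n, h, r).
Variables (i : nat) (m : i.-tuple 'I_l.+2).
Hypothesis il : (1 <= i <= l.+1)%N.
Hypothesis mL : forall k, (1 <= k <= i)%N -> mcomp m k = (l.+2 - k)%N.
Hypothesis sP : is_GT_label (n', h', shift_array r m).
Hypothesis hh' : h = h'.+1.

Local Notation B_ := (Bent r).

(* q^gap = min(1, q^(h - B_i)) is the admissible relative error, because the
   leading weight itself carries the factor q^(B_i). *)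
Definition gap : int := Num.max 0 (h%:Z - B_ i).

Lemma gap_le (x : int) : 0 <= x -> h%:Z - B_ i <= 2 * x -> q ^ (2 * x) <= q ^ gap.
Proof. by move=> x0 xg; apply: qz_le => //; rewrite /gap; zlia. Qed.

Lemma eps01 : 0 <= q ^ gap <= 1.
Proof. by rewrite qz_ge0// qz_le1// /gap; zlia. Qed.

Lemma entry_ge k j : (1 <= k)%N -> (1 <= j)%N -> (j + k <= l.+1)%N -> h%:Z <= entry r k j.
Proof.
move=> k1; case: j => // -[_ kl|j _ kl]; first by apply: (Aent_ge rP); zlia.
by rewrite (label_mid rP)//; zlia.
Qed.

Lemma Bent_next_le k j : (1 <= k)%N -> (1 <= j)%N -> (j + k <= l.+1)%N ->
  B_ k.+1 <= entry r k j.
Proof.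
move=> k1 j1 jk; have [kl|kl] := ltnP k l.
  by apply: le_trans (entry_ge k1 j1 jk); apply: (Bent_le rP); zlia.
have -> : j = 1%N by zlia.
have -> : k = l by zlia.
by rewrite -(ABent rP); apply: (Aent_mono rP); zlia.
Qed.

(** The inequality is strict because of the target: it keeps $B_k$, while its middle entries equal
    $h-1$. This makes the arguments [mid_den2] at least 1. *)
Lemma Bent_lt k : (2 <= k <= i)%N -> (k <= l)%N -> B_ k + 1 <= h%:Z.
Proof.
move=> ki kl; have : Bent (shift_array r m) k <= h'%:Z by apply: (Bent_le sP); zlia.
rewrite /Bent entry_shift ?mL; zlia.
Qed.

Lemma near1_ratio (x y : int) : 0 <= x -> h%:Z - B_ i <= 2 * x ->
  1 <= y -> h%:Z - B_ i <= 2 * y ->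
  near1 (q ^ gap) (1 + 2 * (1 - q ^+ 2)^-1) (qcomp q x / qcomp q y).
Proof.
move=> x0 xg y1 yg; apply: near1_qcomp_ratio => //; first exact: eps01.
  exact: gap_le.
by apply: gap_le => //; zlia.
Qed.

Definition mid_num1 k (j : nat) : int := entry r k j - B_ k.+1 - j%:Z + (l.+2 - k.+1)%N%:Z.
Definition mid_den1 k (j : nat) : int := entry r k j - B_ k - j%:Z + (l.+2 - k)%N%:Z.
Definition mid_num2 k (j : nat) : int := entry r k.+1 j - B_ k - j%:Z + (l.+2 - k)%N%:Z - 1.
Definition mid_den2 k (j : nat) : int := entry r k.+1 j - B_ k.+1 - j%:Z + (l.+2 - k.+1)%N%:Z - 1.

Definition rem_mid (k : nat) : R :=
  \prod_(1 <= j < l.+2 - k) (qcomp q (mid_num1 k j) / qcomp q (mid_den1 k j)) *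
  \prod_(1 <= j < l.+2 - k.+1) (qcomp q (mid_num2 k j) / qcomp q (mid_den2 k j)).

(** In the [k]-th factor each ratio of the first product contributes the exponent $B_{k+1}-B_k+1$
    and each of the second its opposite. The first product has one factor more, and the surplus
    telescopes from $B_1=0$. *)
Lemma Cq_middle_lead :
  Cq_middle q r m = q ^ (B_ i + i%:Z - 1) * \prod_(1 <= k < i) rem_mid k.
Proof.
have -> : q ^ (B_ i + i%:Z - 1) = \prod_(1 <= k < i) q ^ (B_ k.+1 - B_ k + 1).
  rewrite prod_qz//; congr (q ^ _); rewrite big_split /= telescope_sumr; last zlia.
  by rewrite (Bent1 rP) sumr_const_nat natz; zlia.
rewrite /Cq_middle -big_split /=; apply: eq_big_nat => k ki.
rewrite !mL; [|zlia|zlia].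
rewrite !prod_but_last; try zlia.
rewrite (prod_qnum_ratio hq _ (mid_num1 k) (mid_den1 k)).
rewrite (prod_qnum_ratio hq _ (mid_num2 k) (mid_den2 k)).
rewrite mulrACA -qzD//; congr (q ^ _ * _).
rewrite (eq_big_nat _ _ (F2 := fun=> B_ k.+1 - B_ k + 1)); last first.
  by move=> j jk; rewrite /mid_num1 /mid_den1; zlia.
rewrite [X in _ + X](eq_big_nat _ _ (F2 := fun=> - (B_ k.+1 - B_ k + 1))); last first.
  by move=> j jk; rewrite /mid_num2 /mid_den2; zlia.
rewrite !sumr_const_nat (_ : l.+2 - k - 1 = (l.+2 - k.+1 - 1).+1)%N; last zlia.
by rewrite mulrS mulNrn addrK.
Qed.

(** This and the next constants come from composing the [near1] lemmas; they depend only on [q] and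
    [l], as [l.+2] bounds the number of rows and of factors in a row. *)
Definition ratio_err : R := 1 + 2 * (1 - q ^+ 2)^-1.
Definition row_err1 : R := (1 + ratio_err) ^+ l.+2 - 1.
Definition mid_err : R := row_err1 + (1 + row_err1) * row_err1.
Definition midprod_err : R := (1 + mid_err) ^+ l.+2 - 1.

Let ratio_err_ge0 : 0 <= ratio_err.
Proof. by rewrite addr_ge0// mulr_ge0// invr_ge0 ltW// q2_lt1. Qed.

Lemma pow1_ge0 (C : R) N : 0 <= C -> 0 <= (1 + C) ^+ N - 1.
Proof. by move=> C_ge0; rewrite subr_ge0 exprn_ege1// lerDl. Qed.

Let row_err1_ge0 : 0 <= row_err1. Proof. exact: pow1_ge0. Qed.
Let mid_err_ge0 : 0 <= mid_err. Proof. by rewrite addr_ge0// mulr_ge0// addr_ge0. Qed.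
Let midprod_err_ge0 : 0 <= midprod_err. Proof. exact: pow1_ge0. Qed.

Lemma near1_prod_nat (F : nat -> R) (C : R) a b N : 0 <= C -> (b - a <= N)%N ->
  (forall j, (a <= j < b)%N -> near1 (q ^ gap) C (F j)) ->
  near1 (q ^ gap) ((1 + C) ^+ N - 1) (\prod_(a <= j < b) F j).
Proof.
move=> C_ge0 abN FC; apply: near1_prod => //; first exact: eps01.
  by rewrite size_iota.
by move=> j; rewrite mem_index_iota; exact: FC.
Qed.

Lemma mid_args1 k j : (1 <= k < i)%N -> (1 <= j < l.+2 - k)%N ->
  [/\ 0 <= mid_num1 k j, h%:Z - B_ i <= 2 * mid_num1 k j, 1 <= mid_den1 k j
    & h%:Z - B_ i <= 2 * mid_den1 k j].
Proof.
move=> ki jk.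
have hr : h%:Z <= entry r k j by apply: entry_ge; zlia.
have Br : B_ k.+1 <= entry r k j by apply: Bent_next_le; zlia.
have Bi : B_ k.+1 <= B_ i by apply: (Bent_homo rP); zlia.
have BB : B_ k <= B_ k.+1 by apply: (Bent_mono rP); zlia.
have Bh : B_ k <= h%:Z by apply: (Bent_le rP); zlia.
by rewrite /mid_num1 /mid_den1; split; zlia.
Qed.

Lemma mid_args2 k j : (1 <= k < i)%N -> (1 <= j < l.+2 - k.+1)%N ->
  [/\ 0 <= mid_num2 k j, h%:Z - B_ i <= 2 * mid_num2 k j, 1 <= mid_den2 k j
    & h%:Z - B_ i <= 2 * mid_den2 k j].
Proof.
move=> ki jk.
have hr : h%:Z <= entry r k.+1 j by apply: entry_ge; zlia.
have Bi : B_ k.+1 <= B_ i by apply: (Bent_homo rP); zlia.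
have BB : B_ k <= B_ k.+1 by apply: (Bent_mono rP); zlia.
have Bh : B_ k.+1 + 1 <= h%:Z by apply: Bent_lt; zlia.
by rewrite /mid_num2 /mid_den2; split; zlia.
Qed.

Lemma rem_mid_near1 k : (1 <= k < i)%N -> near1 (q ^ gap) mid_err (rem_mid k).
Proof.
move=> ki; apply: near1M => //; first exact: eps01.
  apply: near1_prod_nat => // [|j jk]; first zlia.
  by have [] := mid_args1 ki jk; exact: near1_ratio.
apply: near1_prod_nat => // [|j jk]; first zlia.
by have [] := mid_args2 ki jk; exact: near1_ratio.
Qed.

Lemma qcomp_ratio_ge0 (x y : int) : 0 <= x -> 1 <= y -> 0 <= qcomp q x / qcomp q y.
Proof. by move=> x0 y1; rewrite divr_ge0 ?qcomp_ge0// ltW// qcomp_gt0. Qed.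

Lemma rem_mid_ge0 k : (1 <= k < i)%N -> 0 <= rem_mid k.
Proof.
move=> ki; rewrite mulr_ge0// big_nat prodr_ge0// => j jk.
  by have [? _ ? _] := mid_args1 ki jk; exact: qcomp_ratio_ge0.
by have [? _ ? _] := mid_args2 ki jk; exact: qcomp_ratio_ge0.
Qed.

Definition last_num (k : nat) : int := entry r i.+1 k - B_ i - k%:Z + (l.+2 - i)%N%:Z - 1.
Definition last_den (k : nat) : int := entry r i k - B_ i - k%:Z + (l.+2 - i)%N%:Z.

(** The last numerator of [Cq_last] is $[B_{i+1}-B_i]$, the one argument not controlled by the gap;
    it becomes the root in $\rho$. For [i = l.+1] that product is empty, matching $\rho(z_1)$, which
    has no root. *)
Definition lead_comp : R := if (i <= l)%N then qcomp q (B_ i.+1 - B_ i) else 1.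

Definition rem_last : R :=
  if (i <= l)%N then
    \prod_(1 <= k < l.+1 - i) (qcomp q (last_num k) / qcomp q (last_den k))
      / qcomp q (last_den (l.+1 - i))
  else 1.

Lemma Cq_last_lead :
  Cq_last q r m =
  q ^ (- \sum_(1 <= k < l.+2 - i) (entry r i.+1 k - entry r i k) + (l.+1 - i)%N%:Z)
    * (rem_last * lead_comp).
Proof.
rewrite /Cq_last !mL; last zlia.
rewrite prod_but_last; [|zlia|zlia].
rewrite -prodf_div (prod_qnum_ratio hq _ last_num last_den); congr (q ^ _ * _).
  rewrite (eq_big_nat _ _ (F2 := fun k => - (entry r i.+1 k - entry r i k) + 1)); last first.
    by move=> k _; rewrite /last_num /last_den; zlia.
  by rewrite big_split /= sumrN sumr_const_nat natz; congr (_ + _); zlia.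
rewrite /rem_last /lead_comp; case: leqP => [il1|il1]; last first.
  by rewrite big_geq ?mulr1//; zlia.
rewrite (_ : l.+2 - i = (l.+1 - i).+1)%N; last zlia.
rewrite big_nat_recr; last zlia.
rewrite /= -mulrA [_^-1 * _]mulrC; congr (_ * (qcomp q _ / _)).
rewrite /last_num {2}/Bent (_ : l.+2 - i.+1 = l.+1 - i)%N//; zlia.
Qed.

Definition last_err : R := row_err1 + (1 + row_err1) * (1 / (1 - q ^+ 2)).
Definition mid_last_err : R := midprod_err + (1 + midprod_err) * last_err.
Definition lead_const : R := ratio_err + (1 + ratio_err) * mid_last_err.

Let last_err_ge0 : 0 <= last_err.
Proof.
rewrite addr_ge0// mulr_ge0//; first by rewrite addr_ge0.
by rewrite mul1r invr_ge0 ltW// q2_lt1.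
Qed.

Lemma lead_const_ge0 : 0 <= lead_const.
Proof.
have add1 (C : R) : 0 <= C -> 0 <= 1 + C by exact: addr_ge0.
apply: addr_ge0 => //; apply: mulr_ge0; first exact: add1.
by apply: addr_ge0 => //; apply: mulr_ge0 => //; exact: add1.
Qed.

Lemma last_args k : (i <= l)%N -> (1 <= k < l.+2 - i)%N ->
  [/\ (k < l.+1 - i)%N -> 0 <= last_num k, (k < l.+1 - i)%N -> h%:Z - B_ i <= 2 * last_num k,
      1 <= last_den k & h%:Z - B_ i <= 2 * last_den k].
Proof.
move=> il1 kl.
have hr : h%:Z <= entry r i k by apply: entry_ge; zlia.
have Bh : B_ i <= h%:Z by apply: (Bent_le rP); zlia.
have hr' : (k < l.+1 - i)%N -> h%:Z <= entry r i.+1 k by move=> ?; apply: entry_ge; zlia.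
by rewrite /last_num /last_den; split; zlia.
Qed.

Lemma rem_last_near1 : near1 (q ^ gap) last_err rem_last.
Proof.
have e01 := eps01.
rewrite /rem_last; case: leqP => [il1|_]; last first.
  by apply: near1_le (near1_1 _).
apply: near1M => //.
  apply: near1_prod_nat => // [|k kl]; first zlia.
  have kk : (1 <= k < l.+2 - i)%N by zlia.
  have [x0 xg y1 yg] := last_args il1 kk.
  by apply: near1_ratio => //; [apply: x0|apply: xg]; zlia.
have kk : (1 <= l.+1 - i < l.+2 - i)%N by zlia.
have [_ _ y1 yg] := last_args il1 kk.
apply: near1V; [exact: q2_lt1|exact: qcomp_ge|].
by apply: near1_qcomp => //; apply: gap_le => //; zlia.
Qed.

Lemma rem_last_ge0 : 0 <= rem_last.
Proof.
rewrite /rem_last; case: leqP => [il1|_]//.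
have kl : (1 <= l.+1 - i < l.+2 - i)%N by zlia.
have [_ _ y1 _] := last_args il1 kl.
rewrite divr_ge0//; last by rewrite qcomp_ge0//; zlia.
rewrite big_nat prodr_ge0// => k {}kl.
have kk : (1 <= k < l.+2 - i)%N by zlia.
have [x0 _ y1' _] := last_args il1 kk.
by apply: qcomp_ratio_ge0 => //; apply: x0; zlia.
Qed.

Lemma Cq_sign_lead : Cq_sign R m = 1.
Proof.
rewrite /Cq_sign big_nat big1// => k ki; rewrite ifT// !mL; zlia.
Qed.

Lemma Cq_lead : q ^ (1 - i%:Z) * Cq q r m =
  q ^ B_ i * (Num.sqrt (\prod_(1 <= k < i) rem_mid k) * Num.sqrt rem_last)
    * Num.sqrt lead_comp.
Proof.
rewrite /Cq Cq_sign_lead mulr1 Cq_middle_lead Cq_last_lead.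
rewrite !sqrtrM ?qz_ge0 ?rem_last_ge0// !sqrt_qz//.
set a := Num.sqrt (\prod_(_ <= _ < _) _); set b := Num.sqrt rem_last.
set c := Num.sqrt lead_comp.
rewrite /Cq_exponent !mL; [|zlia|zlia].
rewrite -/(B_ i) (_ : l.+2 - 1 = l.+1)%N ?(label_1last rP); last zlia.
move: (\sum_(1 <= k < l.+2 - i) _) => S.
rewrite -qhalf_double//.
set e1 := 2 * (1 - _); set e2 := _ + S; set e3 := B_ i + _ - 1; set e4 := - S + _.
(* The sum [S] cancels between [e2] and [e4], and the four exponents add up to $2B_i$. *)
have -> : q ^ B_ i = qhalf q e1 * qhalf q e2 * qhalf q e3 * qhalf q e4.
  rewrite -!qhalfD// -qhalf_double//; congr (qhalf q _).
  rewrite /e1 /e2 /e3 /e4; zlia.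
ring.
Qed.

Hypothesis l2 : (2 <= l)%N.

Lemma prefactor_lead :
  qhalf q (- n%:Z) * (Num.sqrt (qnum q (h%:Z + l%:Z - 1))
     / Num.sqrt (qnum q (n%:Z + h%:Z + l%:Z - 1))) =
  Num.sqrt (qcomp q (h%:Z + l%:Z - 1) / qcomp q (n%:Z + h%:Z + l%:Z - 1)).
Proof.
rewrite -sqrtrV; last by rewrite qnum_ge0//; zlia.
rewrite -sqrtrM; last by rewrite qnum_ge0//; zlia.
rewrite qnum_ratio// sqrtrM ?qz_ge0// sqrt_qz// mulrA -qhalfD//.
by rewrite [X in qhalf q X](_ : _ = 0) ?qhalf0 ?mul1r//; zlia.
Qed.

Lemma lead_comp_le1 : 0 <= Num.sqrt lead_comp <= 1.
Proof.
rewrite sqrtr_ge0 -[leRHS]sqrtr1 ler_wsqrtr// /lead_comp.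
by case: ifP => // _; exact: qcomp_le1.
Qed.

Lemma lead_diff :
  `|qhalf q (- n%:Z) * (Num.sqrt (qnum q (h%:Z + l%:Z - 1))
     / Num.sqrt (qnum q (n%:Z + h%:Z + l%:Z - 1))) * (q ^ (1 - i%:Z) * Cq q r m)
    - q ^ B_ i * Num.sqrt lead_comp| <= lead_const * q ^+ h.
Proof.
rewrite prefactor_lead Cq_lead.
set p := Num.sqrt (_ / _); set a := Num.sqrt (\prod_(_ <= _ < _) _).
set b := Num.sqrt rem_last; set c := Num.sqrt lead_comp.
have e01 := eps01.
have BB : 0 <= B_ i by apply: (Bent_ge0 rP).
have pN : near1 (q ^ gap) ratio_err p.
  by apply: near1_sqrt; [apply: qcomp_ratio_ge0; zlia|apply: near1_ratio; zlia].
have aN : near1 (q ^ gap) midprod_err a.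
  apply: near1_sqrt; first by rewrite big_nat prodr_ge0// => k; exact: rem_mid_ge0.
  by apply: near1_prod_nat => // [|k]; [zlia|exact: rem_mid_near1].
have bN : near1 (q ^ gap) last_err b.
  by apply: near1_sqrt; [exact: rem_last_ge0|exact: rem_last_near1].
have ZN : near1 (q ^ gap) lead_const (p * (a * b)) by do 2 apply: near1M => //.
have factor (u v w z : R) : w * (u * z * v) - u * v = u * v * (w * z - 1) by ring.
rewrite factor {factor}.
have /andP[c0 c1] := lead_comp_le1.
rewrite !normrM (ger0_norm (qz_ge0 hq _)) (ger0_norm c0).
apply: (@le_trans _ _ (q ^ B_ i * 1 * (lead_const * q ^ gap))).
  apply: ler_pM => //; first by rewrite mulr_ge0 ?qz_ge0.
  by rewrite ler_wpM2l ?qz_ge0.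
rewrite mulr1 mulrCA -qzD// ler_wpM2l ?lead_const_ge0//.
(* By the choice of [gap], $B_i+gap\ge h$, also when $B_i$ exceeds $h$. *)
by rewrite [leRHS]exprnP qz_le// /gap; zlia.
Qed.

End Leading.

(** * Weights of the shifts *)

Section Decomposition.
Variables (R : realType) (q : R).
Hypothesis hq : 0 < q < 1.
Variables (l i : nat).
Hypothesis l2 : (2 <= l)%N.
Hypothesis il : (1 <= i <= l.+1)%N.

(** The column [x] such that [m] contributes to the entry of $\pi(z_{l+2-i})$ in row [y]; this is
    the [sigma] of the weighted shift attached to [m]. *)
Definition target (m : i.-tuple 'I_l.+2) (y : GT_label l) : option (GT_label l) :=
  if ~~ in_Gamma m then None
  else if mcomp m 1 == 1%N then
    insub ((GT_n y).+1, GT_h y, shift_array (GT_tab y) m)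
  else if mcomp m 1 == l.+1 then
    insub (GT_n y, (GT_h y).-1, shift_array (GT_tab y) m)
  else None.

Definition zstar_coef (m : i.-tuple 'I_l.+2) (y : GT_label l) : R :=
  let n := GT_n y in let h := GT_h y in
  if mcomp m 1 == 1%N then
    qhalf q (- (l + h)%N%:Z)
     * (Num.sqrt (qnum q n.+1%:Z) / Num.sqrt (qnum q (n + h + l + 1)%N%:Z))
     * (q ^+ (l + h) * q ^ (1 - i%:Z) * Cq q (GT_tab y) m)
  else
    qhalf q (- n%:Z)
       * (Num.sqrt (qnum q (h%:Z + l%:Z - 1)) / Num.sqrt (qnum q (n%:Z + h%:Z + l%:Z - 1)))
       * (q ^ (1 - i%:Z) * Cq q (GT_tab y) m).

Definition lead : i.-tuple 'I_l.+2 := [tuple inord (l.+1 - t) | t < i].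

Definition lead_coef_lim (y : GT_label l) : R :=
  q ^ Bent (GT_tab y) i * Num.sqrt (lead_comp q (GT_tab y) i).

(** Rows without a target get the weight 0, so that one bound holds for all rows. *)
Definition shift_coef (m : i.-tuple 'I_l.+2) (y : GT_label l) : R :=
  if target m y is Some _ then zstar_coef m y - lead_coef_lim y *+ (m == lead) else 0.

Lemma mcomp_lead k : (1 <= k <= i)%N -> mcomp lead k = (l.+2 - k)%N.
Proof.
move=> ki; have ki' : (k.-1 < i)%N by zlia.
rewrite /mcomp -[k.-1]/(nat_of_ord (Ordinal ki')) -tnth_nth tnth_mktuple inordK /=; zlia.
Qed.

Lemma mcomp_eq_lead (m : i.-tuple 'I_l.+2) :
  (forall k, (1 <= k <= i)%N -> mcomp m k = (l.+2 - k)%N) -> m = lead.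
Proof.
move=> mL; apply: eq_from_tnth => t; apply: val_inj.
have kt : (1 <= t.+1 <= i)%N by rewrite /= ltn_ord.
have := mL _ kt; rewrite -(mcomp_lead kt) /mcomp /= => E.
by rewrite !(tnth_nth ord0).
Qed.

Lemma lead_Gamma : in_Gamma lead.
Proof.
by apply/forallP => t; rewrite tnth_mktuple inordK; have := ltn_ord t; zlia.
Qed.

Lemma labelP (y : GT_label l) : is_GT_label (GT_n y, GT_h y, GT_tab y).
Proof. by case: y => [[[n h] r] /= yP]. Qed.

Lemma label_eq (x y : GT_label l) : GT_n x = GT_n y -> GT_h x = GT_h y ->
  GT_tab x = GT_tab y -> x = y.
Proof.
move=> xn xh xr; apply: val_inj.
case: x y xn xh xr => [[[n h] r] /= xP] [[[n' h'] r'] /= yP].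
by rewrite /GT_n /GT_h /GT_tab /= => -> -> ->.
Qed.

Variant target_spec (m : i.-tuple 'I_l.+2) (y x : GT_label l) : Prop :=
| TargetUp of mcomp m 1 = 1%N & GT_n x = (GT_n y).+1 & GT_h x = GT_h y
| TargetDown of mcomp m 1 = l.+1 & GT_n x = GT_n y & GT_h y = (GT_h x).+1.

Lemma targetP m y x : target m y = Some x ->
  [/\ in_Gamma m, GT_tab x = shift_array (GT_tab y) m & target_spec m y x].
Proof.
rewrite /target; case: ifPn => // /negPn mG; case: eqP => [m1|_].
  case: insubP => // x' _ xE [<-].
  by rewrite /GT_tab; split=> //; [rewrite xE|apply: TargetUp => //; rewrite /GT_n /GT_h xE].
case: eqP => // m1; case: insubP => // x' xP xE [<-].
have xh : GT_h x' = (GT_h y).-1 by rewrite {1}/GT_h xE.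
have xn : GT_n x' = GT_n y by rewrite {1}/GT_n xE.
have xr : GT_tab x' = shift_array (GT_tab y) m by rewrite {1}/GT_tab xE.
split=> //; apply: TargetDown => //.
(* The entry in position (1,2), a middle one as [l >= 2], drops by 1; this excludes [GT_h y = 0],
   where the predecessor would be truncated. *)
have := label_mid (labelP y) (isT : (0 < 1)%N) (leqnn 2) l2.
have := label_mid (labelP x') (isT : (0 < 1)%N) (leqnn 2) l2.
rewrite xr entry_shift//; last zlia.
rewrite m1 eqxx (_ : (2 == l.+1) = false); last zlia.
by rewrite andbF xh; zlia.
Qed.

(** For fixed [m] the difference between $r^{(m)}$ and $r$ is a fixed array, and $m_1$ determines
    how $n$ and $h$ change. *)
Lemma target_inj m y y' x : target m y = Some x -> target m y' = Some x -> y = y'.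
Proof.
move=> /targetP[_ xr s1] /targetP[_ xr' s2].
have rr : GT_tab y = GT_tab y'.
  apply/ffunP => c; move: xr'; rewrite xr => /ffunP/(_ c); by rewrite !ffunE => /addIr /addIr.
by case: s1 => m1 n1 h1; case: s2 => m2 n2 h2; apply: label_eq => //; zlia.
Qed.

Lemma target_extremal m y x : target m y = Some x ->
  forall k, (1 <= k <= i)%N -> mcomp m k = 1%N \/ mcomp m k = (l.+2 - k)%N.
Proof.
move=> /targetP[mG xr s] k ki.
apply: (@shift_extremal _ (GT_n y) (GT_h y) (GT_n x) (GT_h x) (GT_tab y)) => //.
- exact: labelP.
- by rewrite -xr; exact: labelP.
- by case: s => m1 _ ->; rewrite m1; zlia.
Qed.

Lemma sqrt_ratio_le (x y : int) : 0 <= x -> 0 <= y ->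
  0 <= Num.sqrt (qnum q x) / Num.sqrt (qnum q y) <= qbound q * qhalf q (y - x).
Proof.
move=> x0 y0; rewrite divr_ge0 ?sqrtr_ge0//=.
have b0 : 0 <= qbound q by apply: le_trans (qbound_ge1 hq).
rewrite -sqrtrV ?qnum_ge0// -[qbound q]sqr_sqrtr// expr2 addrC qhalfD// mulrACA.
apply: ler_pM; rewrite ?sqrtr_ge0//.
  by apply: sqrt_le => //; apply: le_trans (qnum_le hq _) _; rewrite ger0_norm.
by apply: sqrt_le => //; apply: le_trans (qnumV_le hq _) _; rewrite ger0_norm.
Qed.

(** The factors bound, in order, the prefactor with its quotient of roots, $q^{1-i}$, and [Cq]
    stripped of its decay. *)
Definition generic_const : R :=
  qbound q * q ^ (- l%:Z) * (Cq_const q l * qhalf q (- (exp_slack l)%:Z)).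

Definition coef_const : R := generic_const + lead_const q l.

Lemma generic_const_ge0 : 0 <= generic_const.
Proof.
rewrite !mulr_ge0 ?qz_ge0 ?qhalf_ge0 ?sqrtr_ge0//.
by apply: le_trans (qbound_ge1 hq).
Qed.

Lemma coef_const_ge0 : 0 <= coef_const.
Proof. by rewrite addr_ge0 ?generic_const_ge0 ?lead_const_ge0. Qed.

Lemma q_exp_le1i : q ^ (1 - i%:Z) <= q ^ (- l%:Z).
Proof. by apply: qz_le => //; zlia. Qed.

Lemma prefactor_le (x y z : int) : 0 <= x -> 0 <= y -> z + (y - x) = 0 ->
  0 <= qhalf q z * (Num.sqrt (qnum q x) / Num.sqrt (qnum q y)) <= qbound q.
Proof.
move=> x0 y0 xyz; have /andP[S0 SB] := sqrt_ratio_le x0 y0.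
rewrite mulr_ge0 ?qhalf_ge0//=.
apply: (@le_trans _ _ (qhalf q z * (qbound q * qhalf q (y - x)))).
  by rewrite ler_wpM2l ?qhalf_ge0.
by rewrite mulrCA -qhalfD// xyz (qhalf0 hq) mulr1.
Qed.

Lemma up_coef_le m y x : target m y = Some x -> mcomp m 1 = 1%N -> GT_h x = GT_h y ->
  `|zstar_coef m y| <= generic_const * q ^+ GT_h x.
Proof.
move=> yx m1 ->; have [mG _ _] := targetP yx; have mE := target_extremal yx.
have CqB : `|Cq q (GT_tab y) m| <= Cq_const q l * qhalf q (- (exp_slack l)%:Z).
  rewrite -[leRHS]mulr1 -(qhalf0 hq); apply: Cq_le => //.
  by rewrite sub0r; exact: (total_exp_ge (labelP y)).
rewrite /zstar_coef m1 eqxx /=.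
have /andP[p0 pB] : 0 <= qhalf q (- (l + GT_h y)%N%:Z) *
    (Num.sqrt (qnum q (GT_n y).+1%:Z) /
     Num.sqrt (qnum q (GT_n y + GT_h y + l + 1)%N%:Z)) <= qbound q.
  by apply: prefactor_le; zlia.
rewrite normrM (ger0_norm p0) normrM [`|_ * q ^ _|]ger0_norm ?mulr_ge0 ?qz_ge0//; last first.
  exact: (qz_ge0 hq (l + GT_h y)%N).
have factor (a b c d : R) : a * b * c * d = a * (d * b * c) by ring.
rewrite [leRHS]factor {factor}.
have qN k : 0 <= q ^+ k by exact: (qz_ge0 hq k).
apply: ler_pM => //; first by rewrite !mulr_ge0 ?qN ?qz_ge0.
apply: ler_pM => //; first by rewrite mulr_ge0 ?qN ?qz_ge0.
apply: ler_pM => //; [exact: qz_ge0| |exact: q_exp_le1i].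
by rewrite [leLHS]exprnP [leRHS]exprnP qz_le//; zlia.
Qed.

Lemma down_coef_le m y x : target m y = Some x -> mcomp m 1 = l.+1 -> m != lead ->
  `|zstar_coef m y| <= generic_const * q ^+ GT_h y.
Proof.
move=> yx m1 ml; have [mG _ _] := targetP yx; have mE := target_extremal yx.
have CqB : `|Cq q (GT_tab y) m|
    <= Cq_const q l * qhalf q (- (exp_slack l)%:Z) * q ^+ GT_h y.
  rewrite [q ^+ _]exprnP -(qhalf_double hq); apply: Cq_le => //.
  apply: (total_exp_ge_last (labelP y)) => //.
  apply: contrapT => nk; move/eqP: ml; apply; apply: mcomp_eq_lead => k ki.
  by apply: contrapT => mk; apply: nk; exists k.
rewrite /zstar_coef m1 (_ : (l.+1 == 1)%N = false); last by zlia.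
have /andP[p0 pB] : 0 <= qhalf q (- (GT_n y)%:Z) *
    (Num.sqrt (qnum q ((GT_h y)%:Z + l%:Z - 1)) /
     Num.sqrt (qnum q ((GT_n y)%:Z + (GT_h y)%:Z + l%:Z - 1))) <= qbound q.
  by apply: prefactor_le; zlia.
rewrite /= normrM (ger0_norm p0) normrM (ger0_norm (qz_ge0 hq _)).
have factor (a b c d : R) : a * b * c * d = a * (b * (c * d)) by ring.
rewrite [leRHS]factor {factor}.
apply: ler_pM => //; first by rewrite mulr_ge0 ?qz_ge0.
by apply: ler_pM; rewrite ?qz_ge0//; exact: q_exp_le1i.
Qed.

Lemma shift_coef_le m y x : target m y = Some x ->
  `|shift_coef m y| <= coef_const * q ^+ GT_h x.
Proof.
move=> yx; have [mG xr s] := targetP yx; rewrite /shift_coef yx.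
have qN k : 0 <= q ^+ k by exact: (qz_ge0 hq k).
have lc0 := lead_const_ge0 hq l; have gc0 := generic_const_ge0.
have genle k : generic_const * q ^+ k <= coef_const * q ^+ k.
  by rewrite ler_wpM2r// lerDl.
case: s => [m1 _ xh|m1 xn yh].
  rewrite (_ : (m == lead) = false) ?mulr0n ?subr0.
    exact: le_trans (up_coef_le yx m1 xh) (genle _).
  by apply/eqP => ml; move: m1; rewrite ml mcomp_lead; zlia.
(* Here [y] has one more $h$ than [x], so a bound at the row implies the one at the column. *)
have yxh : q ^+ GT_h y <= q ^+ GT_h x.
  by rewrite [leLHS]exprnP [leRHS]exprnP qz_le//; zlia.
apply: (@le_trans _ _ (coef_const * q ^+ GT_h y)); last first.
  by rewrite ler_wpM2l ?coef_const_ge0.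
have [ml|ml] := eqVneq m lead; last first.
  by rewrite mulr0n subr0; apply: le_trans (down_coef_le yx m1 ml) (genle _).
rewrite mulr1n; apply: (@le_trans _ _ (lead_const q l * q ^+ GT_h y)); last first.
  by rewrite ler_wpM2r// lerDr.
rewrite /zstar_coef m1 (_ : (l.+1 == 1)%N = false); last by zlia.
apply: (lead_diff hq (labelP y) il _ _ yh l2) => //.
  by move=> k; rewrite ml; exact: mcomp_lead.
by rewrite -xr; exact: labelP.
Qed.

End Decomposition.

(** * Matrix entries and conclusion *)

Section MatrixEntries.
Variables (R : realType) (q : R).
Hypothesis hq : 0 < q < 1.
Variables (l i : nat).
Hypothesis l2 : (2 <= l)%N.
Hypothesis il : (1 <= i <= l.+1)%N.
Variables (H : hilbert R) (e : GT_label l -> H).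
Hypothesis he : orthonormal_basis e.

Lemma pi_zstar_sum (y : GT_label l) :
  pi_zstar_ket q e i (GT_n y) (GT_h y) (GT_tab y) =
  \sum_(m : i.-tuple 'I_l.+2) (zstar_coef q m y)%:C *: oapp e 0 (target m y).
Proof.
rewrite /pi_zstar_ket !scaler_sumr big_mkcond [X in _ + X]big_mkcond -big_split /=.
apply: eq_bigr => m _; rewrite /zstar_coef /target /ket.
have l1 : (l.+1 == 1)%N = false by zlia.
case: (in_Gamma m) => /=; last by rewrite addr0 scaler0.
case: (mcomp m 1 =P 1%N) => [->|_].
  by rewrite [(1 == l.+1)%N]eq_sym l1 addr0 scalerA -rmorphM /=; case: insub.
case: eqP => _; last by rewrite addr0 scaler0.
by rewrite add0r scalerA -rmorphM /=; case: insub.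
Qed.

Lemma hdot_pi_zstar (x y : GT_label l) :
  hdot (e x) (pi_zstar_ket q e i (GT_n y) (GT_h y) (GT_tab y)) =
  \sum_(m : i.-tuple 'I_l.+2) if target m y == Some x then (zstar_coef q m y)%:C else 0.
Proof.
rewrite pi_zstar_sum linear_sumr; apply: eq_bigr => m _.
rewrite linearZr_LR /= (_ : ((zstar_coef q m y)%:C)^* = (zstar_coef q m y)%:C)%R;
  last exact: conjc_real.
case: (target m y) => [z|] /=; last by rewrite linear0r mulr0.
rewrite (basis_dot he) eq_sym -[Some z == Some x]/(z == x).
by case: eqP => _; rewrite ?mulr1 ?mulr0.
Qed.

Local Notation ml := (lead l i).

Lemma entry_lead (r : array l) a b : (0 < a)%N -> (0 < b)%N -> (a + b <= l.+2)%N ->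
  entry (shift_array r ml) a b =
  entry r a b - 1 + ((a <= i)%N && (b == l.+2 - a)%N)%:Z.
Proof.
move=> a0 b0 ab; rewrite entry_shift// (mcomp_lead l2 il); last by zlia.
rewrite (_ : (l.+2 - 1 == l.+1)%N = true); last by zlia.
by case: (leqP a i) => ai /=; [rewrite (mcomp_lead l2 il); zlia|zlia].
Qed.

Lemma Bent_lead (r : array l) k : (1 <= k <= l.+1)%N ->
  Bent (shift_array r ml) k = Bent r k - (i < k)%N%:Z.
Proof. by move=> kl; rewrite /Bent entry_lead; zlia. Qed.

Lemma target_leadP (y x : GT_label l) : target ml y = Some x <->
  [/\ GT_n y = GT_n x, GT_h y = (GT_h x).+1 & GT_tab x = shift_array (GT_tab y) ml].
Proof.
have m1 : mcomp ml 1 = l.+1 by rewrite (mcomp_lead l2 il); zlia.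
split=> [/(targetP l2 il)[_ xr]|[xn xh xr]].
  by case=> [|_ xn xh]; [rewrite m1; zlia|split].
rewrite /target (lead_Gamma l2 il) /= m1 eqxx (_ : (l.+1 == 1)%N = false); last by zlia.
have xE : (GT_n x, GT_h x, GT_tab x) = val x.
  by rewrite /GT_n /GT_h /GT_tab; case: (val x) => [[? ?] ?].
by rewrite xh xn /= -xr xE valK.
Qed.

(** With $n$ and $h$ known, $\mathbf a$ gives the first entries of rows 2 to $l$ and $\mathbf b$ the
    last entries of rows 2 to $l+1$; the rest of the tableau is forced. So the label determines the
    tableau, and raising $\mathbf b$ is undone by the exceptional [m]. *)
Lemma lead_labelsP (x y : GT_label l) :
  (GT_n x, (GT_h x).+1, a_of (GT_h x) (GT_tab x), raise (l.+2 - i) (b_of (GT_h x) (GT_tab x)))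
    = (GT_n y, GT_h y, a_of (GT_h y) (GT_tab y), b_of (GT_h y) (GT_tab y))
  <-> target ml y = Some x.
Proof.
rewrite target_leadP; split=> [E|[xn xh xr]]; last first.
  rewrite xn xh xr; congr (_, _, _, _).
    apply: eq_from_tnth => t; rewrite !tnth_mktuple; have := ltn_ord t => tl.
    by rewrite entry_lead; zlia.
  apply: eq_from_tnth => t; rewrite !tnth_mktuple; have := ltn_ord t => tl.
  by rewrite entry_lead; zlia.
have xn := congr1 (fun p => p.1.1.1) E; have xh := congr1 (fun p => p.1.1.2) E.
have aE := congr1 (fun p => p.1.2) E; have bE := congr1 (fun p => p.2) E.
rewrite /= in xn xh aE bE.
split=> //; apply: entry_inj => a b a0 b0 ab; rewrite entry_lead//.
have aE' c : (2 <= c <= l)%N ->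
    entry (GT_tab x) c 1 - (GT_h x)%:Z = entry (GT_tab y) c 1 - (GT_h y)%:Z.
  move=> cl; have tl : (l - c < l.-1)%N by zlia.
  have := congr1 (fun t => tnth t (Ordinal tl)) aE; rewrite !tnth_mktuple /=.
  by rewrite (_ : l - (l - c) = c)%N//; zlia.
have bE' c : (2 <= c <= l.+1)%N ->
    (GT_h x)%:Z - entry (GT_tab x) c (l.+2 - c) + ((c <= i)%N)%:Z
    = (GT_h y)%:Z - entry (GT_tab y) c (l.+2 - c).
  move=> cl; have tl : (l.+1 - c < l)%N by zlia.
  have := congr1 (fun t => tnth t (Ordinal tl)) bE; rewrite !tnth_mktuple /=.
  rewrite (_ : l.+1 - (l.+1 - c) = c)%N; last by zlia.
  rewrite (_ : (l.+1 - c).+1 = l.+2 - c)%N; last by zlia.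
  (* The component $b_k$ belongs to row $c=l+1-k$, so the raised components are those of the rows up
     to [i]. *)
  by rewrite (_ : ((l.+2 - i).-1 <= l.+1 - c)%N = (c <= i)%N)//; zlia.
have xP := labelP x; have yP := labelP y.
have [ab1|ab1] := leqP (a + b) l.+1.
  have [b2|b2] := leqP 2 b.
    by rewrite (label_mid xP)// (label_mid yP)//; zlia.
  have -> : b = 1%N by zlia.
  have [a2|a2] := leqP 2 a; first by have := aE' a; zlia.
  have -> : a = 1%N by zlia.
  by rewrite (label_11 xP) (label_11 yP); zlia.
have bE0 : b = (l.+2 - a)%N by zlia.
have [a2|a2] := leqP 2 a; first by have := bE' a; rewrite bE0; zlia.
have a1 : a = 1%N by zlia.
have -> : b = l.+1 by zlia.
by rewrite a1 (label_1last xP) (label_1last yP); zlia.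
Qed.

(** The convention $b_l=h$ agrees with $B_1=0$, so one formula covers [k = l]. *)
Lemma bcomp_b_of (x : GT_label l) k : (k <= l)%N ->
  bcomp (GT_h x) (b_of (GT_h x) (GT_tab x)) k =
  (GT_h x)%:Z - Bent (GT_tab x) (l.+1 - k).
Proof.
move=> kl; rewrite /bcomp nth_rcons size_tuple.
case: ltngtP kl => // [kl _|-> _]; last first.
  by rewrite (_ : l.+1 - l = 1)%N ?(Bent1 (labelP x)) ?subr0//; zlia.
rewrite -[k]/(nat_of_ord (Ordinal kl)) -tnth_nth tnth_mktuple /= /Bent.
by rewrite (_ : l.+2 - (l.+1 - k) = k.+1)%N//; zlia.
Qed.

Lemma rho_coeff_lead (x y : GT_label l) : target ml y = Some x ->
  rho_coeff q (l.+2 - i) (GT_h x) (b_of (GT_h x) (GT_tab x)) = lead_coef_lim q i y.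
Proof.
move=> /target_leadP[xn xh xr]; rewrite /rho_coeff /lead_coef_lim /lead_comp.
have Bi : Bent (GT_tab x) i = Bent (GT_tab y) i.
  by rewrite xr Bent_lead ?ltnn ?subr0.
have [il1|il1] := leqP i l; last first.
  rewrite (_ : (l.+2 - i == 1)%N = true); last by zlia.
  rewrite bcomp_b_of// sqrtr1 mulr1 -Bi; congr (q ^ _).
  by rewrite (_ : l.+1 - 0 = i)%N; zlia.
rewrite (_ : (l.+2 - i == 1)%N = false); last by zlia.
rewrite !bcomp_b_of; [|zlia|zlia].
rewrite (_ : l.+1 - (l.+2 - i).-1 = i)%N; last by zlia.
rewrite (_ : l.+1 - (l.+2 - i).-2 = i.+1)%N; last by zlia.
(* Passing from [y] to [x] lowers $B_{i+1}$ by 1 and keeps $B_i$, which absorbs the $+1$ under the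
   root of [rho_coeff]. *)
have Bi1 : Bent (GT_tab x) i.+1 = Bent (GT_tab y) i.+1 - 1.
  by rewrite xr Bent_lead ?ltnSn//; zlia.
rewrite Bi Bi1 /qcomp; congr (q ^ _ * Num.sqrt (1 - q ^ (2 * _))); zlia.
Qed.

Variables (K : hilbert R) (f : Lambda l -> K).
Hypothesis hf : orthonormal_basis f.
Variables (rhoz : nat -> bounded_op K K) (W : bounded_op H K) (Ws : bounded_op K H).
Hypothesis hrho : rho_representation q f rhoz.
Hypothesis hW : W_isometry e f W Ws.

Definition Wlabel (x : GT_label l) : preLambda l :=
  (GT_n x, GT_h x, a_of (GT_h x) (GT_tab x), b_of (GT_h x) (GT_tab x)).

(** A label outside $\Lambda$ would make [W (e x)] the default value 0 of [hket], which $W^*W=1$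
    forbids. *)
Lemma W_basis (x : GT_label l) : exists w : Lambda l, val w = Wlabel x /\ W (e x) = f w.
Proof.
have [WE _ WsW] := hW; have := WE x; rewrite /hket; case: insubP => [w _ wE We|_ We0].
  by exists w.
by have := basis_neq0 he x; rewrite -(WsW (e x)) We0 linear0 eqxx.
Qed.

Lemma hdot_rho (x y : GT_label l) :
  hdot (Ws (rhoz (l.+2 - i)%N (W (e x)))) (e y) =
  if target ml y == Some x then (lead_coef_lim q i y)%:C else 0.
Proof.
have [_ adj _] := hW.
rewrite hdotC -adj -hdotC; have [w [wE ->]] := W_basis x; have [w' [wE' ->]] := W_basis y.
have jl : (1 <= l.+2 - i <= l.+1)%N by zlia.
have := hrho w jl; rewrite wE /Wlabel => ->; rewrite linearZl_LR /= /hket.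
have hd (v : Lambda l) : hdot (f v) (f w') = (val v == val w')%:R.
  by rewrite (basis_dot hf).
(* If the raised label leaves $\Lambda$ the vector is 0; the right side is 0 too, since [w'] carries
   a label in $\Lambda$. *)
have -> : hdot (if insub (GT_n x, (GT_h x).+1, a_of (GT_h x) (GT_tab x),
      raise (l.+2 - i) (b_of (GT_h x) (GT_tab x))) is Some v then f v else 0) (f w')
    = (target ml y == Some x)%:R.
  case: insubP => [v _ vE|nL]; last first.
    rewrite linear0l; case: eqP => // /lead_labelsP E.
    by move: nL; rewrite E -[X in in_Lambda X]wE' (valP w').
  rewrite hd vE wE'; congr (nat_of_bool _)%:R.
  by apply/eqP/eqP => /lead_labelsP.
case: eqP => [yx|_]; last by rewrite mulr0.
by rewrite mulr1 (rho_coeff_lead yx).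
Qed.

End MatrixEntries.

Lemma sum_continuous (R : realType) (H K : hilbert R) (J : Type) (s : seq J) (P : pred J)
    (S : J -> H -> K) : (forall k, continuous (S k)) ->
  continuous (fun v => \sum_(k <- s | P k) S k v).
Proof.
move=> Sc v; elim: s => [|k s IH].
  rewrite (_ : (fun v => _) = fun=> 0); first exact: cvg_cst.
  by apply/funext => w; rewrite big_nil.
rewrite (_ : (fun v => _) = (if P k then S k else fun=> 0)
    \+ (fun v => \sum_(k <- s | P k) S k v)).
  by apply: cvgD => //; case: (P k); [exact: Sc|exact: cvg_cst].
by apply/funext => w /=; rewrite big_cons; case: (P k); rewrite ?add0r.
Qed.

Theorem theorem5p3 (R : realType) (q : R) (hq : 0 < q < 1)
  (l : nat) (hl : (2 <= l)%N)
  (H : hilbert R) (e : GT_label l -> H) (he : orthonormal_basis e)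
  (K : hilbert R) (f : Lambda l -> K) (hf : orthonormal_basis f)
  (piz pizs : nat -> bounded_op H H) (hpi : left_regular q e piz pizs)
  (rhoz : nat -> bounded_op K K) (hrho : rho_representation q f rhoz)
  (W : bounded_op H K) (Ws : bounded_op K H) (hW : W_isometry e f W Ws) :
  forall i : nat, (1 <= i <= l.+1)%N ->
  exists (N : nat) (S : 'I_N -> bounded_op H H) (C : R),
    [/\ forall v : H, piz i v - Ws (rhoz i (W v)) = \sum_(k < N) S k v,
        forall k : 'I_N, shift_operator e (S k)
      & forall (k : 'I_N) (x : GT_label l),
          exists (y : GT_label l) (c : R[i]),
            S k (e x) = c *: e y /\ `|c| <= (C * q ^+ GT_h x)%:C].
Proof.
move=> j jl; pose i := (l.+2 - j)%N.
have il : (1 <= i <= l.+1)%N by rewrite /i; zlia.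
have ji : j = (l.+2 - i)%N by rewrite /i; zlia.
have d_le (m : i.-tuple 'I_l.+2) (y : GT_label l) :
    `|(shift_coef q m y)%:C| <= (coef_const q l)%:C.
  rewrite normc_def /= expr0n addr0 sqrtr_sqr lecR.
  case yx : (target m y) => [x|]; last first.
    by rewrite /shift_coef yx normr0 coef_const_ge0.
  apply: le_trans (shift_coef_le hq hl il yx) _.
  rewrite ler_piMr ?coef_const_ge0// exprn_ile1//; case/andP: hq => /ltW // _ /ltW //.
(* One shift per multi-index; [i] is reversed because the formula with parameter $i$ concerns
   $z_{l+2-i}$. *)
have shifts (m : i.-tuple 'I_l.+2) := weighted_shift he
  (target_inj hl il (m := m)) (coef_const_ge0 hq l) (d_le m).
have [S SP] := choice shifts.
have SE m y x : hdot (S m (e x)) (e y) =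
    if target m y == Some x then (shift_coef q m y)%:C else 0.
  by have [S1 S0] := SP m; exact: (weighted_shift_entry he S1 S0).
exists #|{: i.-tuple 'I_l.+2}|, (fun k => S (enum_val k)), (coef_const q l); split.
- move=> v; rewrite -(big_enum_val (fun m => S m v)) /=; move: v.
  apply: (eq_on_basis he).
  + by move=> a u v; rewrite /= 4!linearP scalerBr opprD addrACA.
  + move=> a u v; rewrite scaler_sumr -big_split /=; apply: eq_bigr => m _.
    by rewrite linearP.
  + move=> v; apply: cvgB; first exact: bop_continuous.
    apply: (continuous_comp (f := rhoz j \o W)); last exact: bop_continuous.
    by apply: continuous_comp; exact: bop_continuous.
  + apply: sum_continuous => m; exact: bop_continuous.
  move=> x; apply: (basis_eq he) => y; rewrite linearBl /= [in rhoz j]ji.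
  rewrite (hdot_rho hl il he hf hrho hW).
  rewrite hpi.1// [in pizs j]ji hpi.2// hdot_pi_zstar// linear_sumlz.
  (* The entry of $W^*\rho W$ is written as a sum over [m] supported at the exceptional one, so that
     the difference can be taken term by term. *)
  rewrite [X in _ - X](_ : _ = \sum_(m : i.-tuple 'I_l.+2) if m == lead l i then
    if target m y == Some x then (lead_coef_lim q i y)%:C else 0 else 0); last first.
    by rewrite -big_mkcond big_pred1_eq.
  rewrite -sumrB; apply: eq_bigr => m _. rewrite /= [RHS](SE m y x) /shift_coef.
  case: eqP => [->|_]; last by case: ifP; rewrite subr0.
  by case: ifP; rewrite ?mulr1n ?mulr0n ?rmorphB /= ?subr0.
- move=> k; exact: (weighted_shift_shift (target_inj hl il (m := enum_val k)) (SE _)).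
move=> k x; have [S1 S0] := SP (enum_val k).
have [[y yx]|nx] := pselect (exists y, target (enum_val k) y = Some x); last first.
  (* On a column without a row the shift vanishes, and any basis vector will do. *)
  exists x, 0; rewrite S0 ?scale0r ?normr0; last by move=> y yx; apply: nx; exists y.
  by split=> //; rewrite ler0c mulr_ge0 ?coef_const_ge0// exprn_ge0// ltW// (q_gt0 hq).
exists y, (shift_coef q (enum_val k) y)%:C; split; first exact: S1.
rewrite normc_def /= expr0n addr0 sqrtr_sqr lecR.
exact: shift_coef_le.
Qed.
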